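(* Let $K=\{z\in\mathbb{C}:|z-1|\leq1\}\cup\{z\in\mathbb{C}:|z+1|\leq1\}$ and let $\mathcal{A}=P(K)$. Then there is no $C^*$-correspondence $X$ over any $C^*$-algebra $A$ such that its tensor algebra $\mathcal{T}_X^+$ is completely isometrically isomorphic to $\mathcal{A}$.
   Context: For a compact set $K\subseteq\mathbb{C}$, $P(K)$ is the closure in $C(K)$ (supremum norm) of the polynomials in $z$ restricted to $K$, regarded as an operator algebra inside the $C^*$-algebra $C(K)$. A $C^*$-correspondence $X$ over a $C^*$-algebra $A$ is a right Hilbert $A$-module with a $*$-homomorphism $\phi_X\colon A\to\mathcal{L}(X)$. A representation of $X$ is a pair $(\pi,t)$ of a $*$-homomorphism $\pi$ of $A$ and a linear map $t$ of $X$ into a $C^*$-algebra with $\pi(a)t(\xi)=t(\phi_X(a)\xi)$ and $t(\xi)^*t(\eta)=\pi(\langle\xi,\eta\rangle_X)$. $\mathcal{T}_X$ is the universal $C^*$-algebra for representations of $X$, and the tensor algebra $\mathcal{T}_X^+$ is the norm-closed subalgebra of $\mathcal{T}_X$ generated by the universal copies of $A$ and $X$. A completely isometric isomorphism is a surjective algebra homomorphism that is isometric at all matrix levels. *)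

(* Defs.v *)
From HB Require Import structures.
From mathcomp Require Import all_boot all_order all_algebra.
From mathcomp Require Import complex.
From mathcomp Require Import all_classical all_reals.
From mathcomp Require Import topology normedtype.
From mathcomp Require Import ring lra.

Set Implicit Arguments.
Unset Strict Implicit.
Unset Printing Implicit Defensive.

Import Order.TTheory GRing.Theory Num.Theory.
Import numFieldNormedType.Exports.

Local Open Scope classical_set_scope.
Local Open Scope ring_scope.
Local Open Scope complex_scope.

(* MathComp-Analysis only puts the norm topology on R[i]^o. *)
HB.instance Definition _ (R : rcfType) := NormedModule.copy R[i] R[i]^o.

(* C*-algebras are not assumed to be unital, so their product cannot be the one
   of the MathComp rings; the zero algebra is allowed. The norm of a normed
   module over R[i] takes its values in R[i], in fact in its nonnegative reals. *)
HB.mixin Record isCstarAlgebra (R : realType) A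
    & CompleteNormedModule R[i] A := {
  cmul : A -> A -> A;
  cstar : A -> A;
  cmulA : associative cmul;
  cmulDl : forall x y z : A, cmul (x + y) z = cmul x z + cmul y z;
  cmulDr : forall x y z : A, cmul x (y + z) = cmul x y + cmul x z;
  cmulZl : forall (k : R[i]) (x y : A), cmul (k *: x) y = k *: cmul x y;
  cmulZr : forall (k : R[i]) (x y : A), cmul x (k *: y) = k *: cmul x y;
  cstarK : involutive cstar;
  cstarD : forall x y : A, cstar (x + y) = cstar x + cstar y;
  cstarZ : forall (k : R[i]) (x : A), cstar (k *: x) = k^* *: cstar x;
  cstarM : forall x y : A, cstar (cmul x y) = cmul (cstar y) (cstar x);
  cnormM : forall x y : A, `|cmul x y| <= `|x| * `|y|;
  cnorm_star : forall x : A, `|cmul (cstar x) x| = `|x| ^+ 2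
}.

#[short(type="cstarAlgType")]
HB.structure Definition CstarAlgebra (R : realType) :=
  {A of CompleteNormedModule R[i] A & isCstarAlgebra R A}.

Record star_morphism (R : realType) (A B : cstarAlgType R) (f : A -> B)
    : Prop := {
  star_morphism_linear : linear f;
  star_morphismM : forall x y, f (cmul x y) = cmul (f x) (f y);
  star_morphism_star : forall x, f (cstar x) = cstar (f x)
}.

(* Right Hilbert A-modules, with an inner product that is linear in its second
   variable. *)
HB.mixin Record isHilbertModule (R : realType) (A : cstarAlgType R) X
    & CompleteNormedModule R[i] X := {
  ract : X -> A -> X;
  inner : X -> X -> A;
  ractM : forall (x : X) (a b : A), ract x (cmul a b) = ract (ract x a) b;
  ractDl : forall (x y : X) (a : A), ract (x + y) a = ract x a + ract y a;
  ractDr : forall (x : X) (a b : A), ract x (a + b) = ract x a + ract x b;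
  ractZl : forall (k : R[i]) (x : X) (a : A), ract (k *: x) a = k *: ract x a;
  ractZr : forall (k : R[i]) (x : X) (a : A), ract x (k *: a) = k *: ract x a;
  innerDr : forall x y z : X, inner x (y + z) = inner x y + inner x z;
  innerZr : forall (k : R[i]) (x y : X), inner x (k *: y) = k *: inner x y;
  inner_ract : forall (x y : X) (a : A), inner x (ract y a) = cmul (inner x y) a;
  inner_star : forall x y : X, inner y x = cstar (inner x y);
  inner_ge0 : forall x : X, exists a : A, inner x x = cmul (cstar a) a;
  hnormE : forall x : X, `|x| ^+ 2 = `|inner x x|
}.

#[short(type="hilbertModType")]
HB.structure Definition HilbertModule (R : realType) (A : cstarAlgType R) :=
  {X of CompleteNormedModule R[i] X & isHilbertModule R A X}.

(* lact_adj says that lact a is an adjointable operator whose adjoint is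
   lact (cstar a); so lact is a *-homomorphism to the adjointable operators. *)
HB.mixin Record isCorrespondence (R : realType) (A : cstarAlgType R) X
    & HilbertModule R A X := {
  lact : A -> X -> X;
  lact_adj : forall (a : A) (x y : X),
    inner (lact a x) y = inner x (lact (cstar a) y) :> A;
  lactD : forall (a b : A) (x : X), lact (a + b) x = lact a x + lact b x;
  lactZ : forall (k : R[i]) (a : A) (x : X), lact (k *: a) x = k *: lact a x;
  lactM : forall (a b : A) (x : X), lact (cmul a b) x = lact a (lact b x)
}.

#[short(type="correspondenceType")]
HB.structure Definition Correspondence (R : realType) (A : cstarAlgType R) :=
  {X of HilbertModule R A X & isCorrespondence R A X}.

Section tensor_algebra.
Variables (R : realType) (A : cstarAlgType R) (X : correspondenceType A).

Record representation (B : cstarAlgType R) (pi : A -> B) (t : X -> B) : Prop := {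
  rep_pi : star_morphism pi;
  rep_linear : linear t;
  rep_lact : forall (a : A) (x : X), cmul (pi a) (t x) = t (lact a x);
  rep_inner : forall x y : X, cmul (cstar (t x)) (t y) = pi (inner x y)
}.

Record universal_representation (T : cstarAlgType R) (pi : A -> T) (t : X -> T)
    : Prop := {
  universal_rep : representation pi t;
  universalP : forall (B : cstarAlgType R) (rho : A -> B) (s : X -> B),
    representation rho s ->
    exists! h : T -> B,
      [/\ star_morphism h, forall a, h (pi a) = rho a & forall x, h (t x) = s x]
}.

End tensor_algebra.

Definition closed_subalgebra (R : realType) (B : cstarAlgType R) (S : set B) : Prop :=
  [/\ closed S, S 0,
      forall (k : R[i]) x y, S x -> S y -> S (k *: x + y)
    & forall x y, S x -> S y -> S (cmul x y)].

Definition tensor_algebra (R : realType) (A : cstarAlgType R)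
    (X : correspondenceType A) (T : cstarAlgType R) (pi : A -> T) (t : X -> T)
    : set T :=
  smallest (@closed_subalgebra R T) (range pi `|` range t).

Section matrix_norm.
Variables (R : realType) (B : cstarAlgType R) (n : nat).

Definition colnorm (b : 'cV[B]_n) : R :=
  Num.sqrt (complex.Re `|\sum_i cmul (cstar (b i 0)) (b i 0)|).

Definition mxaction (M : 'M[B]_n) (b : 'cV[B]_n) : 'cV[B]_n :=
  \col_i \sum_j cmul (M i j) (b j 0).

(* The C*-norm of M_n(B), from its faithful action by adjointable operators on
   the Hilbert B-module B^n. *)
Definition matnorm (M : 'M[B]_n) : R :=
  sup [set colnorm (mxaction M b) | b in [set b | colnorm b <= 1]].

End matrix_norm.

(* Isomorphism of norm-closed subalgebras S1 and S2 of C*-algebras. Phi is a total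
   function, but its values outside S1 are irrelevant. *)
Definition completely_isometrically_isomorphic (R : realType)
    (B1 B2 : cstarAlgType R) (S1 : set B1) (S2 : set B2) : Prop :=
  exists Phi : B1 -> B2,
  [/\ Phi @` S1 = S2,
      forall (k : R[i]) x y, S1 x -> S1 y -> Phi (k *: x + y) = k *: Phi x + Phi y,
      forall x y, S1 x -> S1 y -> Phi (cmul x y) = cmul (Phi x) (Phi y)
    & forall n (M : 'M[B1]_n), (forall i j, S1 (M i j)) ->
        matnorm (map_mx Phi M) = matnorm M].

Section complex_topology.
Variable R : realType.
Implicit Types z w : R[i].

Lemma normc_ge_Im z : `|complex.Im z|%:C <= `|z|.
Proof.
rewrite normc_def lecR -sqrtr_sqr ler_wsqrtr// lerDr sqr_ge0 //.
Qed.

Lemma normc_le_ReIm z : `|z| <= (`|complex.Re z| + `|complex.Im z|)%:C.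
Proof.
rewrite {1}(complexE z) (le_trans (ler_normD _ _))// rmorphD/= lerD//.
  by rewrite normc_def/= expr0n addr0 sqrtr_sqr.
rewrite normrM normc_def/= expr0n add0r expr1n sqrtr1 mul1r.
by rewrite normc_def/= expr0n addr0 sqrtr_sqr.
Qed.

Lemma gt0_realC (e : R[i]) : 0 < e -> exists2 d : R, 0 < d & e = d%:C.
Proof.
move=> e0; exists (complex.Re e); last by rewrite RRe_real// gtr0_real.
by move: e0; rewrite ltcE => /andP[].
Qed.

Lemma realC_gt0 (e : R) : 0 < e -> 0 < e%:C :> R[i].
Proof. by rewrite ltcR. Qed.

Lemma near_dist z (e : R[i]) : 0 < e -> \forall w \near z, `|z - w| < e.
Proof. by move=> e0; apply/nbhs_normP; exists e. Qed.

Lemma lt_normcB z w (e : R) : `|z - w| < e%:C ->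
  `|complex.Re z - complex.Re w| < e /\ `|complex.Im z - complex.Im w| < e.
Proof.
move=> zwe; have := le_lt_trans (normc_ge_Re _) zwe.
have := le_lt_trans (normc_ge_Im _) zwe; rewrite !ltcR.
by case: z w {zwe} => a b [].
Qed.

Lemma Re_continuous : continuous (@complex.Re R : R[i] -> R).
Proof.
move=> z; apply/(@cvgrPdist_lt _ _ _ _ (nbhs_filter z)) => e e0.
apply: filterS (near_dist z (realC_gt0 e0)) => w.
by move=> /lt_normcB[].
Qed.

Lemma Im_continuous : continuous (@complex.Im R : R[i] -> R).
Proof.
move=> z; apply/(@cvgrPdist_lt _ _ _ _ (nbhs_filter z)) => e e0.
apply: filterS (near_dist z (realC_gt0 e0)) => w.
by move=> /lt_normcB[].
Qed.

Lemma complex_cvg (T : Type) (F : set_system T) {FF : Filter F} (f : T -> R[i]) (a b : R) :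
  complex.Re (f x) @[x --> F] --> a -> complex.Im (f x) @[x --> F] --> b ->
  f x @[x --> F] --> a +i* b.
Proof.
move=> fa fb; apply/cvgrPdist_lt => _ /gt0_realC[e e0 ->]; near=> x.
apply: (le_lt_trans (normc_le_ReIm _)); rewrite ltcR (splitr e) ltrD//.
  rewrite (_ : complex.Re _ = a - complex.Re (f x)); last by case: (f x).
  by near: x; apply: cvgr_dist_lt; rewrite // divr_gt0.
rewrite (_ : complex.Im _ = b - complex.Im (f x)); last by case: (f x).
by near: x; apply: cvgr_dist_lt; rewrite // divr_gt0.
Unshelve. all: by end_near. Qed.

Lemma complex_complete (F : set_system R[i]) :
  ProperFilter F -> cauchy F -> cvg F.
Proof.
move=> FF /cauchyP Fc.
have Fce (e : R) : 0 < e -> exists z, F [set w | `|z - w| < e%:C].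
  by move=> /realC_gt0/Fc.
have cRe : cvg (@complex.Re R @ F).
  apply: cauchy_cvg; apply/cauchyP => e e0.
  have [z Fz] := Fce _ e0; exists (complex.Re z).
  by apply: (@filterS _ F _ _ _ _ Fz) => w /lt_normcB[zw _]; exact: zw.
have cIm : cvg (@complex.Im R @ F).
  apply: cauchy_cvg; apply/cauchyP => e e0.
  have [z Fz] := Fce _ e0; exists (complex.Im z).
  by apply: (@filterS _ F _ _ _ _ Fz) => w /lt_normcB[_ zw]; exact: zw.
apply/cvg_ex; exists (lim (@complex.Re R @ F) +i* lim (@complex.Im R @ F)).
exact: (@complex_cvg _ F _ id _ _ cRe cIm).
Qed.

HB.instance Definition _ := Uniform_isComplete.Build R[i] complex_complete.


Lemma conjc_continuous : continuous (@conjc R : R[i] -> R[i]).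
Proof.
move=> z; apply/(@cvgrPdist_lt _ _ _ _ (nbhs_filter z)) => e e0; near=> w.
rewrite -rmorphB normcJ; near: w.
exact: near_dist.
Unshelve. all: by end_near. Qed.

End complex_topology.

(* C(T), with the supremum norm. *)
Definition contalg (R : realType) (T : topologicalType) (cT : compact [set: T]) : Type :=
  continuousType T R[i].

Section contalg.
Variables (R : realType) (T : topologicalType) (cT : compact [set: T]).
Local Notation CT := (contalg R cT).
Implicit Types f g h : CT.

HB.instance Definition _ := Choice.copy CT (continuousType T R[i]).

Lemma contalgP f g : f =1 g -> f = g.
Proof. by move/continuousEP. Qed.

Lemma contalg0_subproof : continuous (fun _ : T => 0 : R[i]).
Proof. by move=> x; exact: cvg_cst. Qed.
Lemma contalgN_subproof f : continuous (fun x => - f x).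
Proof. move=> x; apply: cvgN; exact: (@cts_fun _ _ f). Qed.
Lemma contalgD_subproof f g : continuous (fun x => f x + g x).
Proof. move=> x; apply: cvgD; exact: (@cts_fun _ _ _). Qed.
Lemma contalgM_subproof f g : continuous (fun x => f x * g x).
Proof. move=> x; apply: cvgM; exact: (@cts_fun _ _ _). Qed.
Lemma contalgZ_subproof (k : R[i]) f : continuous (fun x => k * f x).
Proof. move=> x; apply: cvgM; [exact: cvg_cst|exact: (@cts_fun _ _ _)]. Qed.
Lemma contalgJ_subproof f : continuous (fun x => (f x)^*).
Proof.
move=> x; apply: (@continuous_comp _ _ _ f (@conjc R)); first exact: (@cts_fun _ _ f).
exact: conjc_continuous.
Qed.

Definition contalg0 : CT := mkcts contalg0_subproof.
Definition contalgN f : CT := mkcts (@contalgN_subproof f).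
Definition contalgD f g : CT := mkcts (@contalgD_subproof f g).
Definition contalgM f g : CT := mkcts (@contalgM_subproof f g).
Definition contalgZ k f : CT := mkcts (@contalgZ_subproof k f).
Definition contalgJ f : CT := mkcts (@contalgJ_subproof f).


Lemma contalg_addA : associative contalgD.
Proof. by move=> f g h; apply: contalgP => x; exact: addrA. Qed.
Lemma contalg_addC : commutative contalgD.
Proof. by move=> f g; apply: contalgP => x; exact: addrC. Qed.
Lemma contalg_add0 : left_id contalg0 contalgD.
Proof. by move=> f; apply: contalgP => x; exact: add0r. Qed.
Lemma contalg_addN : left_inverse contalg0 contalgN contalgD.
Proof. by move=> f; apply: contalgP => x; exact: addNr. Qed.

HB.instance Definition _ := GRing.isZmodule.Build CT
  contalg_addA contalg_addC contalg_add0 contalg_addN.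

Lemma contalg_scaleA (a b : R[i]) f : contalgZ a (contalgZ b f) = contalgZ (a * b) f.
Proof. by apply: contalgP => x; exact: mulrA. Qed.
Lemma contalg_scale1 : left_id 1 contalgZ.
Proof. by move=> f; apply: contalgP => x; exact: mul1r. Qed.
Lemma contalg_scaleDr : right_distributive contalgZ +%R.
Proof. by move=> k f g; apply: contalgP => x; exact: mulrDr. Qed.
Lemma contalg_scaleDl f : {morph contalgZ^~ f : a b / a + b}.
Proof. by move=> a b; apply: contalgP => x; exact: mulrDl. Qed.

HB.instance Definition _ := GRing.Zmodule_isLmodule.Build R[i] CT
  contalg_scaleA contalg_scale1 contalg_scaleDr contalg_scaleDl.

Definition supnorm f : R := sup (range (fun x => complex.Re `|f x|)).

Lemma normc_Re (z : R[i]) : (complex.Re `|z|)%:C = `|z|.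
Proof. by rewrite normc_def. Qed.

Lemma supnorm_ub f x : `|f x| <= (supnorm f)%:C.
Proof.
rewrite -normc_Re lecR; apply: ub_le_sup; last by exists x.
have cf : continuous (fun x => complex.Re `|f x|).
  move=> y.
  apply: (@continuous_comp _ _ _ (fun y => `|f y|) (@complex.Re R)).
    by apply: cvg_norm; exact: (@cts_fun _ _ f).
  exact: Re_continuous.
have /compact_bounded[M [_ MA]] :=
  continuous_compact (continuous_subspaceT cf) cT.
exists (M + 1) => y /MA My; rewrite (le_trans _ (My _ _)) ?ler_norm ?ltrDl//.
Qed.

Lemma supnorm_le f (M : R) : 0 <= M -> (forall x, `|f x| <= M%:C) -> supnorm f <= M.
Proof.
move=> M0 fM; rewrite /supnorm.
have [[x _]|T0] := pselect (exists x : T, True); last first.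
  rewrite (_ : range (fun x => complex.Re `|f x|) = set0) ?sup0//.
  by apply/seteqP; split=> // y [x _ _]; apply: T0; exists x.
apply: ge_sup => [|_ [y _ <-]]; first by exists (complex.Re `|f x|); exists x.
by rewrite -lecR normc_Re.
Qed.

Lemma supnorm_ge0 f : 0 <= supnorm f.
Proof.
have [[x _]|T0] := pselect (exists x : T, True); last first.
  rewrite /supnorm (_ : range (fun x => complex.Re `|f x|) = set0) ?sup0//.
  by apply/seteqP; split=> // y [x _ _]; apply: T0; exists x.
by rewrite -ler0c (le_trans _ (supnorm_ub f x)).
Qed.

Lemma supnormD f g : (supnorm (f + g))%:C <= (supnorm f)%:C + (supnorm g)%:C.
Proof.
rewrite -rmorphD/= lecR; apply: supnorm_le => [|x].
  by rewrite addr_ge0// supnorm_ge0.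
by rewrite rmorphD (le_trans (ler_normD _ _))// lerD// supnorm_ub.
Qed.

Lemma supnormZ (k : R[i]) f : (supnorm (k *: f))%:C = `|k| * (supnorm f)%:C.
Proof.
set n := complex.Re `|k|; have kE : `|k| = n%:C by rewrite normc_Re.
have n0 : 0 <= n by rewrite -ler0c -kE.
apply/eqP; rewrite eq_le kE -rmorphM !lecR; apply/andP; split.
  apply: supnorm_le => [|x]; first by rewrite mulr_ge0 ?supnorm_ge0.
  by rewrite rmorphM/= -kE normrM ler_wpM2l// supnorm_ub.
have [->|nN0] := eqVneq n 0; first by rewrite mul0r supnorm_ge0.
have {nN0}n_gt0 : 0 < n by rewrite lt_def nN0.
rewrite mulrC -ler_pdivlMr//; apply: supnorm_le => [|x].
  by rewrite divr_ge0 ?supnorm_ge0.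
rewrite rmorphM fmorphV/= ler_pdivlMr ?ltcR//.
by rewrite mulrC -kE -normrM; exact: (supnorm_ub (k *: f) x).
Qed.

Lemma supnorm_eq0 f : (supnorm f)%:C = 0 -> f = 0.
Proof.
move=> f0; apply: contalgP => x; apply/eqP.
by rewrite -normr_le0 -f0 supnorm_ub.
Qed.

HB.instance Definition _ := Lmodule_isNormed.Build R[i] CT
  supnormD supnormZ supnorm_eq0.

Lemma contalg_normE f : `|f| = (supnorm f)%:C. Proof. by []. Qed.

Lemma contalg_complete (F : set_system CT) : ProperFilter F -> cauchy F -> cvg F.
Proof.
move=> FF /cauchyP Fc.
have Fce (e : R) : 0 < e ->
    exists f, F [set g | forall x, `|f x - g x| <= e%:C].
  move=> /realC_gt0/Fc[f Ff]; exists f; apply: (@filterS _ F _ _ _ _ Ff) => g.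
  rewrite -ball_normE => fg x.
  by rewrite (le_trans (supnorm_ub (f - g) x))// ltW.
have ptc x : cvg ((fun f : CT => f x) @ F).
  apply: cauchy_cvg; apply/cauchyP => _ /gt0_realC[e e0 ->].
  have [f Ff] := Fce _ (divr_gt0 e0 (ltr0n R 2)).
  exists (f x); apply: (@filterS _ F _ _ _ _ Ff) => g /(_ x) fg.
  rewrite /= -ball_normE; apply: (le_lt_trans fg).
  by rewrite ltcR ltr_pdivrMr// mulr2n mulrDr mulr1 ltrDl.
pose l x := lim ((fun f : CT => f x) @ F).
have Fl (e : R) : 0 < e -> F [set g | forall x, `|l x - g x| <= e%:C].
  move=> e0; have e4 : 0 < e / 4 by rewrite divr_gt0.
  have [f Ff] := Fce _ e4; apply: (@filterS _ F _ _ _ _ Ff) => g fg x.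
  have /cvgrPdist_lt/(_ _ (realC_gt0 (divr_gt0 e0 (ltr0n R 2)))) := ptc x.
  move=> /(filterI Ff)/filter_ex[h [/(_ x) fh lh]].
  rewrite (_ : l x - g x = (l x - h x) - (f x - h x) + (f x - g x)); last first.
    by ring.
  rewrite (le_trans (ler_normD _ _))//.
  rewrite (_ : e = e / 2 + e / 4 + e / 4); last by field.
  rewrite !rmorphD/= lerD//.
  by rewrite (le_trans (ler_normB _ _))// lerD// ltW.
have lc : continuous l.
  move=> x; apply/(@cvgrPdist_lt _ _ _ _ (nbhs_filter x)) => _ /gt0_realC[e e0 ->].
  have e4 : 0 < e / 4 by rewrite divr_gt0.
  have /filter_ex[g lg] := Fl _ e4.
  have gx : g y @[y --> x] --> g x by exact: (@cts_fun _ _ g).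
  move/cvgrPdist_lt : gx => /(_ _ (realC_gt0 e4)); apply: filterS => y gxy.
  rewrite (_ : l x - l y = (l x - g x) + (g x - g y) - (l y - g y)); last first.
    by ring.
  rewrite (le_lt_trans (ler_normB _ _))//.
  apply: (@le_lt_trans _ _ (e / 4 + e / 4 + e / 4)%:C).
    rewrite !rmorphD/= lerD//.
    by rewrite (le_trans (ler_normD _ _))// lerD// ltW.
  by rewrite ltcR; lra.
apply/cvg_ex; exists (mkcts lc : CT); apply/fcvgrPdist_lt => _ /gt0_realC[e e0 ->].
have e2 : 0 < e / 2 by rewrite divr_gt0.
apply: (@filterS _ F _ _ _ _ (Fl _ e2)) => g lg.
rewrite contalg_normE ltcR; apply: (@le_lt_trans _ _ (e / 2)); last by lra.
by apply: supnorm_le => [|x]; [exact: ltW|exact: (lg x)].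
Qed.

HB.instance Definition _ := Uniform_isComplete.Build CT contalg_complete.

Lemma contalg_mulA : associative (@contalgM).
Proof. by move=> f g h; apply: contalgP => x; exact: mulrA. Qed.
Lemma contalg_mulDl f g h : contalgM (f + g) h = contalgM f h + contalgM g h.
Proof. by apply: contalgP => x; exact: mulrDl. Qed.
Lemma contalg_mulDr f g h : contalgM f (g + h) = contalgM f g + contalgM f h.
Proof. by apply: contalgP => x; exact: mulrDr. Qed.
Lemma contalg_mulZl (k : R[i]) f g : contalgM (k *: f) g = k *: contalgM f g.
Proof. by apply: contalgP => x; exact: esym (mulrA _ _ _). Qed.
Lemma contalg_mulZr (k : R[i]) f g : contalgM f (k *: g) = k *: contalgM f g.
Proof. by apply: contalgP => x; exact: mulrCA. Qed.
Lemma contalg_starK : involutive contalgJ.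
Proof. by move=> f; apply: contalgP => x; exact: conjcK. Qed.
Lemma contalg_starD f g : contalgJ (f + g) = contalgJ f + contalgJ g.
Proof. by apply: contalgP => x; exact: rmorphD. Qed.
Lemma contalg_starZ (k : R[i]) f : contalgJ (k *: f) = k^* *: contalgJ f.
Proof. by apply: contalgP => x; exact: rmorphM. Qed.
Lemma contalg_starM f g : contalgJ (contalgM f g) = contalgM (contalgJ g) (contalgJ f).
Proof. by apply: contalgP => x; rewrite [RHS]mulrC; exact: rmorphM. Qed.
Lemma contalg_normM f g : `|contalgM f g| <= `|f| * `|g|.
Proof.
rewrite !contalg_normE -rmorphM/= lecR; apply: supnorm_le => [|x].
  by rewrite mulr_ge0 ?supnorm_ge0.
by rewrite rmorphM/= normrM ler_pM// supnorm_ub.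
Qed.
Lemma contalg_norm_star f : `|contalgM (contalgJ f) f| = `|f| ^+ 2.
Proof.
apply/eqP; rewrite eq_le; apply/andP; split.
  rewrite !contalg_normE -rmorphXn/= lecR; apply: supnorm_le => [|x].
    by rewrite sqr_ge0.
  rewrite normrM normcJ rmorphXn/= expr2 ler_pM// supnorm_ub//.
rewrite !contalg_normE -rmorphXn/= lecR.
set n := supnorm (contalgM _ _).
have n0 : 0 <= n by exact: supnorm_ge0.
rewrite -[leRHS](sqr_sqrtr n0) ler_pXn2r ?nnegrE ?supnorm_ge0 ?sqrtr_ge0//.
apply: supnorm_le => [|x]; first exact: sqrtr_ge0.
rewrite -(@ler_pXn2r _ 2) ?nnegrE ?ler0c ?sqrtr_ge0//;
  last by rewrite -ler0c normc_Re.
have -> : (Num.sqrt n)%:C ^+ 2 = n%:C by rewrite -rmorphXn/= sqr_sqrtr.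
apply: le_trans (supnorm_ub _ x).
by rewrite normrM normcJ expr2.
Qed.

HB.instance Definition _ := isCstarAlgebra.Build R CT contalg_mulA contalg_mulDl
  contalg_mulDr contalg_mulZl contalg_mulZr contalg_starK contalg_starD
  contalg_starZ contalg_starM contalg_normM contalg_norm_star.
End contalg.

Lemma compact_set_type (T : topologicalType) (K : set T) :
  compact K -> compact [set: set_type K].
Proof.
move=> cK F FF _.
have [|p [Kp clp]] := cK (set_val @ F) _.
  by apply: (@filterE _ F); move=> x; exact: set_valP.
exists (exist _ p (mem_set Kp)); split=> // A B FA [_ [[V oV <-]]] /= Vp VB.
have [||_ [[a Aa <-] Va]] := clp (set_val @` A) V.
- by apply: (@filterS _ F _ _ _ _ FA) => a Aa; exists a.
- by apply: open_nbhs_nbhs; split.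
- by exists a; split=> //; apply: VB.
Qed.

Definition polynomial_algebra (R : realType) (K : set R[i]) (cK : compact K) :
    set (contalg R (compact_set_type cK)) :=
  closure [set f : contalg R (compact_set_type cK) |
    exists p : {poly R[i]}, forall z : set_type K, f z = p.[set_val z]].

Arguments polynomial_algebra {R K} cK.

Definition two_discs (R : realType) : set R[i] :=
  [set z | `|z - 1| <= 1] `|` [set z | `|z + 1| <= 1].

Arguments two_discs R : clear implicits.

Lemma closed_disc (R : realType) (c : R[i]) : closed [set z : R[i] | `|z - c| <= 1].
Proof.
rewrite (_ : mkset _ = (fun z : R[i] => complex.Re `|z - c|) @^-1` [set x | x <= 1]).
  apply: preimage_closed; last exact: closed_le.
  move=> y _.
  apply: (@continuous_comp _ _ _ (fun y : R[i] => `|y - c|) (@complex.Re R)).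
    apply: (@cvg_norm _ _ _ (nbhs y) (nbhs_filter y)).
    apply: (@cvgB _ _ _ (nbhs y) (nbhs_filter y)); first exact: cvg_id.
    exact: cvg_cst.
  exact: Re_continuous.
by apply/funext => z; rewrite /mkset /preimage /mkset -lecR normc_Re.
Qed.

Lemma two_discs_compact (R : realType) : compact (two_discs R).
Proof.
pose g (p : R * R) : R[i] := p.1 +i* p.2.
have cg : continuous g.
  by move=> p; apply: complex_cvg; [exact: cvg_fst|exact: cvg_snd].
have cI := @segment_compact R (- 2) 2.
apply: (@subclosed_compact _ _ (g @` (`[- 2, 2] `*` `[- 2, 2]))).
- apply: closedU; first exact: closed_disc.
  rewrite (_ : mkset _ = [set z | `|z - (- 1)| <= 1]); first exact: closed_disc.
  by apply/seteqP; split=> z /=; rewrite opprK.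
- by apply: continuous_compact; [exact: continuous_subspaceT|exact: compact_setX].
- move=> z zK.
  have z2 : `|z| <= (2%:R)%:C.
    have [/= h|/= h] := zK.
      rewrite -(subrK 1 z) (le_trans (ler_normD _ _))// normr1.
      by rewrite rmorph_nat -natr1 lerD.
    rewrite -(addrK 1 z) (le_trans (ler_normB _ _))// normr1.
    by rewrite rmorph_nat -natr1 lerD.
  exists (complex.Re z, complex.Im z); last by case: (z).
  split=> /=; rewrite in_itv/= -ler_norml -lecR (le_trans _ z2)//.
  - exact: normc_ge_Re.
  - exact: normc_ge_Im.
Qed.

Arguments two_discs_compact R : clear implicits.

(* Main.v *)
Require Import Defs.
From mathcomp Require Import reals.
From HB Require Import structures.
From mathcomp Require Import all_boot all_order all_algebra.
From mathcomp Require Import cyclic separable cyclotomic complex.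
From mathcomp Require Import all_classical all_reals.
From mathcomp Require Import topology normedtype sequences.
From mathcomp Require Import ring lra zify.

Set Implicit Arguments.
Unset Strict Implicit.
Unset Printing Implicit Defensive.

Import Order.TTheory GRing.Theory Num.Theory.
Import numFieldNormedType.Exports.

Local Open Scope classical_set_scope.
Local Open Scope ring_scope.
Local Open Scope complex_scope.

(** Let S be the tensor algebra of a correspondence X over A, with universal
    representation (pi, t), and suppose that Phi maps S isometrically onto P(K),
    where K consists of two discs tangent at 0. Let e in S be the element with
    Phi e = 1. It is a unit for S, which is commutative like P(K).

    By Arens' argument (eval_cstar), Phi turns adjoints inside S into complex
    conjugates. Since pi(A) is closed under adjoints, Phi (pi a) and its conjugate
    are both uniform limits of polynomials on K, so Phi (pi a) is constant on each
    disc and hence on K (polynomial_algebra_conj_const). Thus pi(A) is contained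
    in C e. As t(x)^* t(y) is in pi(A), commutativity then makes the range of t at
    most one-dimensional. It is not 0, for otherwise S would consist of multiples
    of e. So S is generated by e and an element v = t(x1) with v^* v = e.

    The description of pi and t by scalars shows that for each unimodular l there
    is a representation of X on the complex numbers in which t(x1) acts as l. By
    universality it is given by a character of T that sends v to l, and this
    character is contractive (character_contractive). So P(K) is generated by
    f = Phi v, a function with values in the unit disc, and has for every l on the
    unit circle a contractive character sending f to l. Thus f would identify P(K)
    with the disc algebra, whereas removing the point 0 disconnects K and removing
    a point from a disc does not. The lemma two_discs_no_disc_coordinate derives
    the contradiction from the circle alone, by means of the maximum principle
    (max_modulus) and of the fact that the polynomially convex hull of K meets the
    imaginary axis only at 0 (imaginary_inverted). *)

(** * Polynomials on the unit circle *)

Section polynomials_on_circle.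
Variable R : realType.
Local Notation C := R[i].
Implicit Types (p q : {poly C}) (z w e : C).

Lemma unity_root_exists n : (0 < n)%N -> exists z : C, n.-primitive_root z.
Proof.
move=> n_gt0; have [r Dp] := closed_field_poly_normal ('X^n - 1 : {poly C}).
rewrite (monicP _) ?monicXnsubC // scale1r in Dp.
have rn1 : all n.-unity_root r by apply/allP=> z; rewrite -root_prod_XsubC -Dp.
have sz_r : (n < (size r).+1)%N.
  by rewrite -(size_prod_XsubC r id) -Dp size_XnsubC.
have [|z _ pz] := hasP (has_prim_root n_gt0 rn1 _ sz_r); last by exists z.
by rewrite -separable_prod_XsubC -Dp separable_Xn_sub_1 // pnatr_eq0 -lt0n.
Qed.

Lemma norm_unity_root n z : n.-primitive_root z -> `|z| = 1.
Proof.
move=> pz; apply/eqP; rewrite -(@pexpr_eq1 _ _ n) ?normr_ge0 ?(prim_order_gt0 pz)//.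
by rewrite -normrX prim_expr_order// normr1.
Qed.

Lemma sum_unity_root n z j : n.-primitive_root z ->
  \sum_(k < n) z ^+ (k * j) = (n %| j)%:R * n%:R.
Proof.
move=> pz; case: (boolP (n %| j)%N) => nj.
  rewrite mul1r (eq_bigr (fun=> 1)) ?sumr_const ?card_ord// => k _.
  by apply/eqP; rewrite -(prim_order_dvd pz) dvdn_mull.
rewrite mul0r.
have zj1 : z ^+ j != 1 by rewrite -(prim_order_dvd pz).
apply: (mulfI (_ : z ^+ j - 1 != 0)); first by rewrite subr_eq0.
under eq_bigr do rewrite mulnC exprM.
by rewrite mulr0 -subrX1 -exprM mulnC exprM (prim_expr_order pz) expr1n subrr.
Qed.

(** Discrete Fourier coefficient of p - conj q at the n-th roots of unity. On
    them, z ^ (n - j) plays the role of z ^ (- j) and conj z = z ^ (n - 1), so the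
    coefficient i of q contributes only if n divides i + j, which the bound on n
    forbids: conj q has no positive frequency. *)
Lemma coef_average n p q z j : n.-primitive_root z ->
    (size p <= n)%N -> (j + size q < n)%N -> (0 < j)%N ->
  \sum_(k < n) z ^+ (k * (n - j)) * (p.[z ^+ k] - conjc q.[z ^+ k]) = n%:R * p`_j.
Proof.
move=> pz pn qn j0.
have n0 := prim_order_gt0 pz.
have jn : (j < n)%N by rewrite (leq_ltn_trans _ qn)// leq_addr.
have conj_zk k : conjc (z ^+ k) = z ^+ (k * n.-1).
  have zk0 : z ^+ k != 0.
    by rewrite expf_neq0// -normr_eq0 (norm_unity_root pz) oner_eq0.
  apply: (mulfI zk0); rewrite -sqr_normc normrX (norm_unity_root pz) !expr1n.
  by rewrite -exprD -mulnS prednK// mulnC exprM (prim_expr_order pz) expr1n.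
have conj_q k : conjc q.[z ^+ k] =
    \sum_(i < size q) conjc q`_i * z ^+ (k * (n.-1 * i)).
  rewrite horner_coef (rmorph_sum (@conjc R)); apply: eq_bigr => i _.
  transitivity (conjc q`_i * conjc (z ^+ k) ^+ i).
    by rewrite (rmorphM (@conjc R)) -(rmorphXn (@conjc R)).
  by rewrite conj_zk -exprM mulnA.
under eq_bigr do rewrite mulrBr.
rewrite sumrB [X in _ - X](_ : _ = 0) ?subr0; last first.
  under eq_bigr => k _.
    rewrite conj_q mulr_sumr.
    under eq_bigr => i _ do rewrite mulrCA -exprD -mulnDr.
    over.
  rewrite exchange_big/= big1// => i _.
  rewrite -mulr_sumr (sum_unity_root _ pz).
  have ij : ~~ (n %| i + j)%N.
    rewrite gtnNdvd ?addn_gt0 ?j0 ?orbT// (leq_ltn_trans _ qn)// addnC leq_add2l.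
    exact: ltnW.
  suff -> : (n %| n - j + n.-1 * i)%N = false by rewrite mul0r mulr0.
  apply: contraNF ij => nd; rewrite -(dvdn_addr _ nd).
  have -> : (n - j + n.-1 * i + (i + j) = n * i.+1)%N.
    case: n n0 jn {pz pn qn nd conj_zk conj_q} => // n _ jn /=; rewrite mulnS mulSn; lia.
  exact: dvdn_mulr.
under eq_bigr => k _.
  rewrite (horner_coef_wide _ pn) mulr_sumr.
  under eq_bigr => i _ do rewrite mulrCA -exprM -exprD -mulnDr.
  over.
rewrite exchange_big/= (bigD1 (Ordinal jn))//= [X in _ + X]big1 ?addr0 => [|i ij].
  by rewrite -mulr_sumr (sum_unity_root _ pz) subnK 1?ltnW// dvdnn mul1r mulrC.
rewrite -mulr_sumr (sum_unity_root _ pz).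
suff -> : (n %| n - j + i)%N = false by rewrite mul0r mulr0.
apply: contraNF ij => /dvdnP[[|[|k]] nd]; apply/eqP/val_inj => /=; move: nd (ltn_ord i) jn.
- lia.
- lia.
- by rewrite !mulSn; lia.
Qed.

(** With q = 0 this is Cauchy's estimate; in general it says that only the
    constant term of p can be large when p is close to an antiholomorphic
    function. *)
Lemma coef_le_circle p q e j : (0 < j)%N ->
    (forall z, `|z| = 1 -> `|p.[z] - conjc q.[z]| <= e) -> `|p`_j| <= e.
Proof.
move=> j0 pqe; pose n := (size p + (j + size q)).+1.
have [z pz] := unity_root_exists (ltn0Sn _ : 0 < n)%N.
have z1 := norm_unity_root pz.
have avg := @coef_average n p q z j pz (leqW (leq_addr _ _)) (leq_addl _ _) j0.
have n0 : 0 < n%:R :> C by rewrite ltr0n.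
rewrite -(ler_pM2l n0) -[X in X * _ <= _](normr_nat _ n) -normrM -avg.
rewrite (le_trans (ler_norm_sum _ _ _))// mulr_natl.
apply: (@le_trans _ _ (\sum_(k < n) e)); last by rewrite sumr_const card_ord.
apply: ler_sum => k _; rewrite normrM normrX z1 expr1n mul1r pqe//.
by rewrite normrX z1 expr1n.
Qed.

(** Bernoulli's inequality makes the powers of x / y > 1 unbounded. *)
Lemma le_of_exp_le (a x y : R) : 0 <= x -> 0 <= y ->
  (forall m, x ^+ m <= a * y ^+ m) -> x <= y.
Proof.
move=> x0 y0 xy; rewrite leNgt; apply/negP => yx.
have [y00|yN0] := eqVneq y 0.
  by have := xy 1%N; rewrite y00 !expr1 mulr0 leNgt; case/negP; rewrite -y00.
have {}y0 : 0 < y by rewrite lt_def yN0.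
pose d := x / y - 1; have d0 : 0 < d by rewrite subr_gt0 ltr_pdivlMr ?mul1r.
have bern m : 1 + m%:R * d <= (x / y) ^+ m.
  elim: m => [|m IH]; first by rewrite mul0r addr0 expr0.
  rewrite exprS; have -> : x / y = 1 + d by rewrite /d; ring.
  apply: (@le_trans _ _ ((1 + d) * (1 + m%:R * d))).
    have md : 0 <= m%:R * d * d by rewrite !mulr_ge0// ltW.
    by rewrite -natr1; nra.
  rewrite ler_pM2l; last by lra.
  by rewrite (le_trans IH)// (_ : x / y = 1 + d)// /d; ring.
have bnd m : m%:R * d <= a.
  have : (x / y) ^+ m <= a by rewrite expr_div_n ler_pdivrMr ?exprn_gt0.
  by have := bern m; lra.
have := bnd (Num.bound (a / d)); rewrite -ler_pdivlMr// leNgt.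
have a0 : 0 <= a by have := xy 0%N; rewrite !expr0 mulr1; lra.
by rewrite archi_boundP// divr_ge0// ltW.
Qed.

Lemma norm_geometric_le (w : C) n : `|w| < 1 ->
  \sum_(j < n) `|w| ^+ j <= (1 - `|w|)^-1.
Proof.
move=> w1; rewrite -[leRHS]mul1r ler_pdivlMr ?subr_gt0// mulrC.
rewrite -opprB mulNr -subrX1 opprB lerBlDr lerDl.
by rewrite exprn_ge0.
Qed.

(** Cauchy's estimates for p ^ m and a geometric series give the bound up to the
    factor 1 / (1 - |w|), which does not depend on m; taking m-th roots removes
    it. *)
Lemma max_modulus p (M : C) : (forall z, `|z| = 1 -> `|p.[z]| <= M) ->
  forall w, `|w| <= 1 -> `|p.[w]| <= M.
Proof.
move=> pM w; rewrite le_eqVlt => /predU1P[/pM//|w1].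
have M0 : 0 <= M by rewrite (le_trans _ (pM 1 (normr1 _))).
have bnd m : `|p.[w]| ^+ m <= (1 - `|w|)^-1 * M ^+ m.
  have coefM j : `|(p ^+ m)`_j| <= M ^+ m.
    (* The estimate excludes index 0, so the coefficients are shifted by one. *)
    have -> : (p ^+ m)`_j = ('X * p ^+ m)`_j.+1 by rewrite coefXM.
    apply: (@coef_le_circle _ 0) => // z z1.
    rewrite horner0 conjc0 subr0 hornerM hornerX horner_exp normrM z1 mul1r normrX.
    by rewrite lerXn2r ?nnegrE ?pM.
  rewrite -normrX -horner_exp horner_coef (le_trans (ler_norm_sum _ _ _))//.
  rewrite (le_trans _ (ler_wpM2r _ (norm_geometric_le (size (p ^+ m)) w1))) ?exprn_ge0//.
  rewrite mulr_suml; apply: ler_sum => i _; rewrite normrM normrX mulrC.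
  by rewrite ler_wpM2l ?exprn_ge0.
have Mr : M \is Num.real by rewrite ger0_real.
have wr : (1 - `|w|)^-1 \is Num.real by rewrite realV realB ?real1 ?normr_real.
move: bnd; rewrite -(RRe_real Mr) -(RRe_real wr) -normc_Re => bnd.
rewrite lecR; apply: (@le_of_exp_le (complex.Re (1 - `|w|)^-1)).
- by rewrite -ler0c normc_Re.
- by rewrite -ler0c RRe_real.
- by move=> m; have := bnd m; rewrite -!rmorphXn -rmorphM lecR.
Qed.
End polynomials_on_circle.

(** * Functions holomorphic and antiholomorphic on a disc *)

Section antiholomorphic.
Variable R : realType.
Local Notation C := R[i].
Implicit Types (p q : {poly C}) (z w e : C).

Lemma horner_continuous p : continuous (fun z : C => p.[z]).
Proof.
elim/poly_ind: p => [|p c IH] z.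
  rewrite (_ : (fun z0 : C => _) = fun => 0); last first.
    by apply/funext => y; rewrite horner0.
  exact: (@cvg_cst _ _ _ (nbhs z) (nbhs_filter z)).
rewrite (_ : (fun z0 : C => _) = fun z => p.[z] * z + c); last first.
  by apply/funext => y; rewrite hornerMXaddC.
apply: (@cvgD _ _ _ (nbhs z) (nbhs_filter z)).
  by apply: (@cvgM _ _ (nbhs z) (nbhs_filter z)); [exact: IH|exact: cvg_id].
exact: (@cvg_cst _ _ _ (nbhs z) (nbhs_filter z)).
Qed.

Lemma horner_near p z e : 0 < e ->
  exists2 d, 0 < d & forall w, `|z - w| < d -> `|p.[z] - p.[w]| < e.
Proof.
move=> e0; have pz := @horner_continuous p z.
have /nbhs_normP[d d0 dz] : \forall w \near z, `|p.[z] - p.[w]| < e.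
  exact: (proj1 (@cvgrPdist_lt _ _ _ _ (nbhs_filter z) _ _) pz _ e0).
by exists d => // w /dz.
Qed.

Lemma near_interior c z (d : C) : `|z - c| <= 1 -> 0 < d ->
  exists2 w, `|z - w| < d & `|w - c| < 1.
Proof.
move=> zc /gt0_realC[r r0 ->].
pose t : R := Num.min (r / 2) (1 / 2).
have t0 : 0 < t by rewrite lt_min !divr_gt0.
have tr : t < r by rewrite (@le_lt_trans _ _ (r / 2)) ?ge_min ?lexx//; lra.
have t1 : t < 1 by rewrite (@le_lt_trans _ _ (1 / 2)) ?ge_min ?lexx ?orbT//; lra.
exists (z - t%:C * (z - c)).
  rewrite opprB addrCA subrr addr0 normrM ger0_norm ?ler0c ?(ltW t0)//.
  rewrite (@le_lt_trans _ _ t%:C) ?ltcR//.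
  by rewrite ler_piMr ?ler0c ?(ltW t0).
have -> : z - t%:C * (z - c) - c = (1 - t)%:C * (z - c) by rewrite rmorphB; ring.
rewrite normrM ger0_norm ?ler0c ?subr_ge0 ?(ltW t1)//.
rewrite (@le_lt_trans _ _ (1 - t)%:C) ?ltcR//; last by lra.
by rewrite ler_piMr ?ler0c ?subr_ge0 ?(ltW t1).
Qed.

(** A function which, like its conjugate, is a uniform limit of polynomials on a
    closed disc is constant there: on the unit circle around c an approximant p is
    close to the conjugate of a polynomial, so its nonconstant Taylor coefficients
    at c are small, and so is p z - p c inside. The boundary follows by continuity
    of p. *)
Lemma const_of_conj_approx (u : C -> C) c :
    (forall e, 0 < e -> exists p q, forall z, `|z - c| <= 1 ->
       `|p.[z] - u z| <= e /\ `|q.[z] - conjc (u z)| <= e) ->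
  forall z, `|z - c| <= 1 -> u z = u c.
Proof.
move=> uapp.
have cc : `|c - c| <= 1 by rewrite subrr normr0 ler01.
have eq_eps z w : (forall e, 0 < e -> `|u z - u w| <= e) -> u z = u w.
  move=> zw; apply/eqP; rewrite -subr_eq0 -normr_le0.
  by apply/ler_addgt0Pl => e e0; rewrite addr0 zw.
have interior z : `|z - c| < 1 -> u z = u c.
  move=> zc; apply: eq_eps => e e0.
  set r : C := `|z - c| in zc.
  have r0 : 0 <= r by exact: normr_ge0.
  have r1 : 0 < (1 - r)^-1 by rewrite invr_gt0 subr_gt0.
  have k0 : 0 < 2 + 2 * (1 - r)^-1 by rewrite addr_gt0 ?mulr_gt0 ?ltr0n.
  pose d : C := e / (2 + 2 * (1 - r)^-1).
  have d0 : 0 < d by rewrite divr_gt0.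
  have [p [q pq]] := uapp d d0.
  pose P := p \Po ('X + c%:P); pose Q := q \Po ('X + c%:P).
  have PE w : P.[w] = p.[w + c] by rewrite horner_comp !hornerE.
  have QE w : Q.[w] = q.[w + c] by rewrite horner_comp !hornerE.
  have coefP j : (0 < j)%N -> `|P`_j| <= 2 * d.
    move=> j0; apply: (@coef_le_circle _ _ Q) => // w w1; rewrite PE QE.
    have [|pw qw] := pq (w + c); first by rewrite addrK w1.
    rewrite (_ : _ - _ = (p.[w + c] - u (w + c)) - conjc (q.[w + c] - conjc (u (w + c)))).
      rewrite (le_trans (ler_normB _ _))// normcJ mulr2n mulrDl mul1r lerD//.
    by rewrite (rmorphB (@conjc R)) /= conjcK; ring.
  have PzPc : `|p.[z] - p.[c]| <= 2 * d * (1 - r)^-1.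
    rewrite -[z](subrK c) -[in p.[c]](add0r c) -!PE.
    have [->|P0] := eqVneq P 0.
      by rewrite !horner0 subrr normr0 mulr_ge0 ?(ltW r1)// mulr_ge0 ?(ltW d0).
    rewrite horner_coef0 horner_coef.
    have : (0 < size P)%N by rewrite size_poly_gt0.
    case: (size P) => // n _; rewrite big_ord_recl expr0 mulr1 addrC addKr.
    rewrite (le_trans (ler_norm_sum _ _ _))//.
    apply: (@le_trans _ _ (2 * d * \sum_(j < n) r ^+ j)); last first.
      by apply: ler_wpM2l; [rewrite mulr_ge0 ?(ltW d0)|exact: norm_geometric_le].
    rewrite mulr_sumr; apply: ler_sum => i _; rewrite normrM normrX -/r.
    apply: ler_pM; rewrite ?exprn_ge0 ?normr_ge0//; first by apply: coefP; rewrite lift0.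
    by rewrite lift0 exprS ler_piMl ?exprn_ge0// ltW.
  have [pz _] := pq z (ltW zc); have [pc _] := pq c cc.
  rewrite (_ : u z - u c = (p.[z] - p.[c]) - (p.[z] - u z) + (p.[c] - u c)); last by ring.
  rewrite (le_trans (ler_normD _ _))// (le_trans (lerD (ler_normB _ _) (lexx _)))//.
  rewrite (le_trans (lerD (lerD PzPc pz) pc))//.
  rewrite (_ : _ + _ = d * (2 + 2 * (1 - r)^-1)); last by ring.
  by rewrite divfK ?gt_eqF.
move=> z zc; apply: eq_eps => e e0.
have d0 : 0 < e / 3%:R by rewrite divr_gt0 ?ltr0n.
have [p [q pq]] := uapp _ d0.
have [d dp pd] := horner_near p z d0.
have [w zw wc] := near_interior zc dp.
have [pz _] := pq z zc; have [pw _] := pq w (ltW wc).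
rewrite -(interior _ wc).
rewrite (_ : u z - u w = (p.[z] - p.[w]) - (p.[z] - u z) + (p.[w] - u w)); last by ring.
rewrite (le_trans (ler_normD _ _))// (le_trans (lerD (ler_normB _ _) (lexx _)))//.
rewrite (le_trans (lerD (lerD (ltW (pd _ zw)) pz) pw))//.
by rewrite (_ : _ + _ = e)//; field.
Qed.
End antiholomorphic.

(** * Polynomial inverses on the two discs *)

Section two_tangent_discs.
Variable R : realType.
Local Notation C := R[i].
Implicit Types (p q : {poly C}) (z w e : C) (t : R).

Lemma exists_exp_le (r d : R) : 0 <= r -> r < 1 -> 0 < d -> exists n, r ^+ n <= d.
Proof.
move=> r0 r1 d0; apply: contrapT => /forallNP rd.
suff : 1 <= r by rewrite leNgt r1.
apply: (@le_of_exp_le _ d^-1) => // m.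
by rewrite expr1n mulrC ler_pdivlMr// mul1r ltW// ltNge; apply/negP.
Qed.

(** z - w is invertible in P(K), phrased without that algebra. *)
Definition poly_inverts (K : set C) w : Prop :=
  forall d : R, 0 < d -> exists q, forall z, K z -> `|q.[z] * (z - w) - 1| <= d%:C.

Lemma norm_geometric_poly_le (b : C) (r : R) n : r < 1 -> `|b| <= r%:C ->
  `|\sum_(k < n) b ^+ k| <= ((1 - r)^-1)%:C.
Proof.
move=> r1 br.
have b1 : `|b| < 1 by rewrite (le_lt_trans br)// ltcR.
rewrite (le_trans (ler_norm_sum _ _ _))//.
under eq_bigr do rewrite normrX.
rewrite (le_trans (norm_geometric_le _ b1))// fmorphV rmorphB lef_pV2 ?posrE.
- by rewrite lerD2l lerN2.
- by rewrite subr_gt0.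
- by rewrite subr_gt0 ltcR.
Qed.

(** Pushing the pole from w to w': if q nearly inverts z - w, then
    q * \sum_k ((w' - w) q) ^ k, cut off at a large exponent, nearly inverts
    z - w', because |(w' - w) q| is at most 2/3 on K. *)
Lemma poly_inverts_near (K : set C) w w' :
  (forall z, K z -> `|w' - w| <= (1 / 2)%:C * `|z - w|) ->
  poly_inverts K w -> poly_inverts K w'.
Proof.
have [->//|w'w] := eqVneq w' w; move=> near_w inv_w d d0.
have [n rn] : exists n, (2 / 3 : R) ^+ n <= d / 2.
  by apply: exists_exp_le; lra.
pose d1 : R := Num.min (1 / 3) (d / 6).
have d10 : 0 < d1 by rewrite lt_min; apply/andP; split; lra.
have d13 : d1 <= 1 / 3 by rewrite ge_min lexx.
have d16 : d1 <= d / 6 by rewrite ge_min lexx orbT.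
have [q qP] := inv_w _ d10.
exists (q * \sum_(k < n) ((w' - w) *: q) ^+ k) => z Kz.
have zw : z - w != 0.
  apply: contraTneq (near_w _ Kz) => ->.
  by rewrite normr0 mulr0 normr_le0 subr_eq0.
set a := q.[z] * (z - w); have a1 : `|a - 1| <= d1%:C by exact: qP.
pose b := (w' - w) * q.[z].
have bE : \sum_(k < n) b ^+ k = (\sum_(k < n) ((w' - w) *: q) ^+ k).[z].
  by rewrite horner_sum; apply: eq_bigr => k _; rewrite horner_exp hornerZ.
have b23 : `|b| <= (2 / 3)%:C.
  rewrite -(ler_pM2r (_ : 0 < `|z - w|)) ?normr_gt0//.
  have -> : `|b| * `|z - w| = `|w' - w| * `|a| by rewrite !normrM mulrA.
  have a43 : `|a| <= (4 / 3)%:C.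
    rewrite -(subrK 1 a) (le_trans (ler_normD _ _))// normr1.
    by rewrite (le_trans (lerD a1 (lexx _)))// -(rmorph1 (real_complex R)) -rmorphD lecR; lra.
  rewrite (le_trans (ler_pM _ _ (near_w _ Kz) a43))//.
  by rewrite mulrAC -rmorphM ler_wpM2r// lecR; lra.
rewrite hornerM -bE.
have -> : q.[z] * (\sum_(k < n) b ^+ k) * (z - w') - 1 =
    (a - 1) * (\sum_(k < n) b ^+ k) - b ^+ n.
  have geo : (b - 1) * (\sum_(k < n) b ^+ k) = b ^+ n - 1 by rewrite -subrX1.
  have -> : b ^+ n = (b - 1) * (\sum_(k < n) b ^+ k) + 1 by rewrite geo subrK.
  by rewrite /a /b; ring.
rewrite (le_trans (ler_normB _ _))// normrM normrX.
have geo3 : `|\sum_(k < n) b ^+ k| <= 3%:R%:C.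
  rewrite (le_trans (norm_geometric_poly_le _ _ b23))//; first by lra.
  by rewrite lecR (_ : (1 - 2 / 3)^-1 = 3 :> R)//; field.
have bn : `|b| ^+ n <= (d / 2)%:C.
  apply: (@le_trans _ _ ((2 / 3)%:C ^+ n)); last by rewrite -rmorphXn lecR.
  by rewrite lerXn2r ?nnegrE ?normr_ge0 ?ler0c//; lra.
rewrite (le_trans (lerD (ler_pM _ _ a1 geo3) bn))//.
by rewrite -rmorphM -rmorphD lecR; lra.
Qed.

Lemma two_discs_norm z : two_discs R z -> `|z| <= 2.
Proof.
move=> [/= h|/= h].
  rewrite -(subrK 1 z) (le_trans (ler_normD _ _))// normr1.
  by rewrite -natr1 lerD.
rewrite -(addrK 1 z) (le_trans (ler_normB _ _))// normr1.
by rewrite -natr1 lerD.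
Qed.

(** The point t i is at distance sqrt (1 + t ^ 2) from both centres, hence at
    distance at least sqrt (1 + t ^ 2) - 1 from the discs. *)
Lemma two_discs_dist_imaginary (d t : R) z : 0 <= d -> (1 + d) ^+ 2 <= 1 + t ^+ 2 ->
  two_discs R z -> d%:C <= `|z - t *i|.
Proof.
move=> d0 dt Kz.
have far (s : R) : s ^+ 2 = 1 -> (1 + d)%:C <= `|s%:C - t *i|.
  move=> s1; rewrite normc_def /= add0r subr0 s1 sqrrN lecR -(ger0_norm (_ : 0 <= 1 + d)).
    by rewrite -sqrtr_sqr ler_sqrt// addr_ge0 ?sqr_ge0.
  by lra.
have near_center (s : R) : s ^+ 2 = 1 -> `|z - s%:C| <= 1 -> d%:C <= `|z - t *i|.
  move=> /far + zs; rewrite (_ : _ - _ = (z - t *i) - (z - s%:C)); last by ring.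
  move=> /le_trans/(_ (ler_normB _ _))/le_trans/(_ (lerD (lexx _) zs)).
  by rewrite rmorphD rmorph1 addrC lerD2r.
case: Kz => /= zK; [apply: (near_center 1)|apply: (near_center (-1))].
- by rewrite expr1n.
- by rewrite rmorph1.
- by rewrite sqrrN expr1n.
- by rewrite rmorphN rmorph1 opprK.
Qed.

Lemma norm_imaginary t : `|t *i| = `|t|%:C :> C.
Proof. by rewrite normc_def /= expr0n add0r sqrtr_sqr. Qed.

(** Runge's theorem at the points of the imaginary axis. Far out, z - s i is
    inverted by a geometric series in z; the pole is then pushed towards t i in
    steps of length d / 2, where d bounds from below the distance to the two discs
    of all points s i with |s| >= |t|. *)
Lemma imaginary_inverted t : t != 0 -> poly_inverts (two_discs R) (t *i).
Proof.
move=> t0.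
pose d := Num.sqrt (1 + t ^+ 2) - 1.
have t20 : 0 < t ^+ 2 by rewrite exprn_even_gt0.
have dE : (1 + d) ^+ 2 = 1 + t ^+ 2.
  by rewrite addrC subrK sqr_sqrtr// addr_ge0 ?sqr_ge0.
have d0 : 0 < d.
  by rewrite subr_gt0 -{1}sqrtr1 ltr_sqrt// ?ltrDl// addr_gt0.
have far (s : R) z : `|t| <= `|s| -> two_discs R z -> d%:C <= `|z - s *i|.
  move=> ts; apply: two_discs_dist_imaginary; first exact: ltW.
  by rewrite dE lerD2l -(real_normK (num_real t)) -(real_normK (num_real s)) lerXn2r ?nnegrE.
have large (s : R) : 4 <= `|s| -> poly_inverts (two_discs R) (s *i).
  move=> s4 e e0.
  have [n rn] : exists n, (1 / 2 : R) ^+ n <= e by apply: exists_exp_le; lra.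
  have sN0 : s *i != 0.
    by rewrite eq_complex /= eqxx -normr_eq0 /=; apply: lt0r_neq0; lra.
  exists (- (s *i)^-1 *: \sum_(k < n) ((s *i)^-1 *: 'X) ^+ k) => z Kz.
  rewrite hornerZ horner_sum.
  have -> : \sum_(k < n) (((s *i)^-1 *: 'X) ^+ k).[z] = \sum_(k < n) (z / s *i) ^+ k.
    by apply: eq_bigr => k _; rewrite horner_exp hornerZ hornerX mulrC.
  set S := \sum_(k < n) _.
  have geo : (z / s *i - 1) * S = (z / s *i) ^+ n - 1 by rewrite -subrX1.
  have -> : - (s *i)^-1 * S * (z - s *i) - 1 = - (z / s *i) ^+ n.
    have -> : - (s *i)^-1 * S * (z - s *i) = - ((z / s *i - 1) * S) by field.
    by rewrite geo; ring.
  rewrite normrN normrX.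
  apply: (@le_trans _ _ ((1 / 2)%:C ^+ n)); last by rewrite -rmorphXn lecR.
  rewrite lerXn2r ?nnegrE ?normr_ge0 ?ler0c//; first by lra.
  rewrite normrM normfV ler_pdivrMr ?normr_gt0//.
  rewrite (le_trans (two_discs_norm Kz))// norm_imaginary.
  by rewrite -rmorphM -(rmorph_nat (real_complex R)) lecR; lra.
have chain n : forall s, `|t| <= `|s| -> 4 - n%:R * (d / 2) <= `|s| ->
    poly_inverts (two_discs R) (s *i).
  elim: n => [s _|n IH s ts sn]; first by rewrite mul0r subr0; exact: large.
  have [s' [s's ss']] : exists s', `|s'| = `|s| + d / 2 /\ `|s - s'| = d / 2.
    have [s0|s0] := lerP 0 s; [exists (s + d / 2)|exists (s - d / 2)].
      by split; [rewrite !ger0_norm//; lra|rewrite ler0_norm; lra].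
    by split; [rewrite !ltr0_norm//; lra|rewrite ger0_norm; lra].
  apply: (@poly_inverts_near _ (s' *i)); last first.
    apply: IH; rewrite s's; first by lra.
    by move: sn; rewrite -natr1; lra.
  move=> z Kz; apply: le_trans (_ : (1 / 2)%:C * d%:C <= _); last first.
    rewrite ler_wpM2l// ?ler0c; first by lra.
    by apply: far => //; rewrite s's; lra.
  have -> : s *i - s' *i = (s - s') *i by simpc.
  by rewrite norm_imaginary ss' -rmorphM lecR; lra.
have tn : 4 <= (Num.bound (8 / d))%:R * (d / 2).
  have : 8 / d < (Num.bound (8 / d))%:R by apply: archi_boundP; rewrite divr_ge0// ltW.
  by rewrite ltr_pdivrMr//; lra.
apply: (chain (Num.bound (8 / d)) t (lexx _)).
by apply: le_trans (normr_ge0 t); rewrite subr_le0.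
Qed.
End two_tangent_discs.

(** * The unit circle minus a point *)

Section circle_minus_a_point.
Variable R : realType.
Local Notation C := R[i].
Implicit Types (p q : {poly C}) (z w e l : C) (s t : R).

(** The Cayley transform (s + i) / (s - i), which parametrizes the unit circle
    minus the point 1. *)
Definition cayley s : C := ((s ^+ 2 - 1) / (s ^+ 2 + 1)) +i* (2 * s / (s ^+ 2 + 1)).

Lemma cayley_den_gt0 s : 0 < s ^+ 2 + 1.
Proof. by rewrite ltr_wpDl ?sqr_ge0. Qed.

Lemma norm_cayley s : `|cayley s| = 1.
Proof.
have s0 := cayley_den_gt0 s.
rewrite normc_def /= (_ : _ + _ = 1) ?sqrtr1//.
by field; rewrite gt_eqF.
Qed.

Lemma cayley_neq1 s : cayley s != 1.
Proof.
have s0 := cayley_den_gt0 s.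
apply/eqP => /(congr1 (@complex.Re R))/(congr1 ( *%R^~ (s ^+ 2 + 1))) /=.
by rewrite divfK ?gt_eqF// mul1r; lra.
Qed.

Lemma cayley_surj l : `|l| = 1 -> l != 1 -> exists s, l = cayley s.
Proof.
case: l => a b; rewrite normc_def /= => -[ab1] l1.
have {}ab1 : a ^+ 2 + b ^+ 2 = 1.
  by rewrite -[LHS]sqr_sqrtr ?addr_ge0 ?sqr_ge0// ab1 expr1n.
have a1 : 1 - a != 0.
  apply: contraNneq l1 => a1; have {}a1 : a = 1 by lra.
  have : b ^+ 2 = 0 by move: ab1; rewrite a1 expr1n; lra.
  by move=> /eqP; rewrite sqrf_eq0 => /eqP->; rewrite a1.
exists (b / (1 - a)).
have b2 : b ^+ 2 = (1 - a) * (1 + a) by move: ab1; lra.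
have sE : (b / (1 - a)) ^+ 2 = (1 + a) / (1 - a).
  by rewrite expr_div_n b2 expr2 -mulf_div divff// mul1r.
rewrite /cayley sE; congr (_ +i* _); field; rewrite a1 /=; lra.
Qed.

Lemma cayley_continuous : continuous cayley.
Proof.
move=> s; have s0 := cayley_den_gt0 s.
have c2 : (fun t => t ^+ 2) x @[x --> s] --> s ^+ 2.
  by apply: cvgM; exact: cvg_id.
have cd : ((x ^+ 2 + 1)^-1 : R) @[x --> s] --> (s ^+ 2 + 1)^-1.
  apply: cvgV; first by rewrite gt_eqF.
  by apply: cvgD => //; exact: cvg_cst.
apply: complex_cvg; apply: cvgM => //=.
  by apply: cvgB => //; exact: cvg_cst.
by apply: cvgM; [exact: cvg_cst|exact: cvg_id].
Qed.

Lemma same_sign (h : R -> R) s t : continuous h -> (forall x, h x != 0) ->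
  0 < h s -> 0 < h t.
Proof.
move=> ch h0 hs; rewrite ltNge le_eqVlt (negbTE (h0 t))/=; apply/negP => ht.
have ch' a b : {within `[a, b], continuous h} by exact: continuous_subspaceT.
have [st|/ltW ts] := leP s t.
  have [|x _ /eqP] := @IVT _ h s t 0 st (ch' _ _); last by rewrite (negbTE (h0 x)).
  by rewrite ge_min le_max (ltW ht) (ltW hs) orbT.
have [|x _ /eqP] := @IVT _ h t s 0 ts (ch' _ _); last by rewrite (negbTE (h0 x)).
by rewrite ge_min le_max (ltW ht) (ltW hs) orbT.
Qed.

(** The circle minus a point is a continuous image of the line, so the
    intermediate value theorem applies to Re g along it; g is only known as a
    uniform limit of polynomials on the circle, which makes it continuous. *)
Lemma circle_sign_constant (g : C -> C) l0 l1 l2 :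
    (forall e, 0 < e -> exists p, forall l, `|l| = 1 -> `|p.[l] - g l| <= e) ->
    `|l0| = 1 -> `|l1| = 1 -> `|l2| = 1 -> l1 != l0 -> l2 != l0 ->
    (forall l, `|l| = 1 -> l != l0 -> complex.Re (g l) != 0) ->
  0 < complex.Re (g l1) -> 0 < complex.Re (g l2).
Proof.
move=> gapp n0 n1 n2 l10 l20 gN0.
have l00 : l0 != 0 by rewrite -normr_eq0 n0 oner_eq0.
have param l : `|l| = 1 -> l != l0 -> exists s, l = l0 * cayley s.
  move=> nl ll0; have [||s sE] := @cayley_surj (l0^-1 * l).
  - by rewrite normrM normfV n0 nl invr1 mulr1.
  - by apply: contra ll0 => /eqP ll; rewrite -[l](mulKf l00) mulrCA ll mulr1.
  - by exists s; rewrite -sE mulVKf.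
have nparam s : `|l0 * cayley s| = 1 by rewrite normrM n0 norm_cayley mulr1.
have [s1 ->] := param _ n1 l10; have [s2 ->] := param _ n2 l20.
pose h s := complex.Re (g (l0 * cayley s)).
apply: (@same_sign h) => [s|s]; last first.
  apply: gN0 => //; rewrite -[X in _ != X]mulr1.
  by apply: contra (cayley_neq1 s) => /eqP/(mulfI l00) ->.
have cl : (l0 * cayley x) @[x --> s] --> l0 * cayley s.
  apply: (@cvgM _ _ (nbhs s)); last exact: cayley_continuous.
  exact: cvg_cst.
apply/cvgrPdist_lt => e e0.
have e3 : 0 < (e / 3)%:C :> C by rewrite ltcR; lra.
have [p pg] := gapp _ e3.
have cp : p.[l0 * cayley x] @[x --> s] --> p.[l0 * cayley s].
  apply: (@cvg_comp _ _ _ _ (fun z => p.[z]) _ _ _ cl).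
  exact: horner_continuous.
near=> x.
have px : `|p.[l0 * cayley s] - p.[l0 * cayley x]| < (e / 3)%:C.
  by near: x; exact: (proj1 (@cvgrPdist_lt _ _ _ _ _ _ _) cp).
rewrite -ltcR.
have Qx := pg _ (nparam x); have Ps := pg _ (nparam s).
set P := p.[l0 * cayley s] in px Ps; set Q := p.[l0 * cayley x] in px Qx.
have -> : h s - h x = complex.Re (g (l0 * cayley s) - g (l0 * cayley x)).
  by rewrite /h; case: (g _) => ? ?; case: (g _).
rewrite (le_lt_trans (normc_ge_Re _))//.
rewrite (_ : _ - _ = (P - Q) - (P - g (l0 * cayley s)) + (Q - g (l0 * cayley x))); last by ring.
rewrite (le_lt_trans (ler_normD _ _))// (le_lt_trans (lerD (ler_normB _ _) Qx))//.
rewrite [ltRHS](_ : _ = (e / 3)%:C + (e / 3)%:C + (e / 3)%:C).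
  by rewrite ltrD2r ltr_leD.
by rewrite -!rmorphD; congr (_%:C); field.
Unshelve. all: by end_near. Qed.

End circle_minus_a_point.

(** * P(K) has no disc coordinate *)

Section two_discs_versus_disc.
Variable R : realType.
Local Notation C := R[i].
Implicit Types (p q : {poly C}) (z w e l : C).
Local Notation K := (two_discs R).

(** There is no coordinate f on K = two_discs R with values in the unit disc that
    generates P(K) and for which every point l of the unit circle carries a
    character of P(K) sending f to l; the last hypothesis describes this character
    by its value w = g l at the coordinate z.

    Since |q (g l)| <= sup_K |q|, the point g l lies in K as far as the imaginary
    axis can tell: if g l = t i with t != 0, then z - t i would be both invertible
    in P(K) and killed by the character. So Re (g l) vanishes only if g l = 0, that
    is, only if l = f 0, and it has constant sign on the rest of the circle. Hence
    g maps the circle to one half of the disc of radius 2, say the right one, where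
    |w - 2| <= 2 sqrt 2 < 3. If p (f z) is close to z on K, then p is close to g on
    the circle, so |p - 2| is at most about 3 there, and by the maximum principle
    also at f (-2); but p (f (-2)) is close to -2. *)
Lemma two_discs_no_disc_coordinate (f : C -> C) :
    (forall z, K z -> `|f z| <= 1) ->
    (forall e, 0 < e -> exists p, forall z, K z -> `|p.[f z] - z| <= e) ->
    (forall e, 0 < e -> exists q, forall z, K z -> `|q.[z] - f z| <= e) ->
    (forall l, `|l| = 1 -> exists w,
      [/\ forall p e, (forall z, K z -> `|p.[f z] - z| <= e) -> `|p.[l] - w| <= e,
          forall q e, (forall z, K z -> `|q.[z]| <= e) -> `|q.[w]| <= e
        & forall q e, (forall z, K z -> `|q.[z] - f z| <= e) -> `|q.[w] - l| <= e]) ->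
  False.
Proof.
move=> f1 gen_f gen_z chars.
have /choice[g gP] : forall l, exists w, `|l| = 1 ->
    [/\ forall p e, (forall z, K z -> `|p.[f z] - z| <= e) -> `|p.[l] - w| <= e,
        forall q e, (forall z, K z -> `|q.[z]| <= e) -> `|q.[w]| <= e
      & forall q e, (forall z, K z -> `|q.[z] - f z| <= e) -> `|q.[w] - l| <= e].
  move=> l; have [/chars[w ?]|lN1] := pselect (`|l| = 1); first by exists w.
  by exists 0.
have K0 : K 0 by left; rewrite /= sub0r normrN normr1.
have g2 l : `|l| = 1 -> `|g l| <= 2.
  move=> /gP[_ hull _]; have := hull 'X 2.
  by rewrite hornerX; apply => z Kz; rewrite hornerX two_discs_norm.
have g_app e : 0 < e -> exists p, forall l, `|l| = 1 -> `|p.[l] - g l| <= e.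
  by move=> /gen_f[p pf]; exists p => l /gP[+ _ _]; apply.
have g_imag l : `|l| = 1 -> complex.Re (g l) = 0 -> g l = 0.
  move=> /gP[_ hull _]; case gE : (g l) => [a t] /= a0; rewrite a0 in gE *.
  have [->//|t0] := eqVneq t 0.
  exfalso; have half0 : 0 < 1 / 2 :> R by lra.
  have [q qK] := imaginary_inverted t0 half0.
  have : `|(q * ('X - (t *i)%:P) - 1).[g l]| <= (1 / 2)%:C.
    by apply: hull => z /qK; rewrite !hornerE.
  rewrite gE !hornerE subrr mulr0 sub0r normrN normr1.
  by rewrite -(rmorph1 (real_complex R)) lecR; lra.
have g_zero l : `|l| = 1 -> complex.Re (g l) = 0 -> l = f 0.
  move=> l1 /(g_imag _ l1) g0; have [_ _ gl] := gP _ l1.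
  apply/eqP; rewrite -subr_eq0 -normr_le0; apply/ler_addgt0Pl => e e0; rewrite addr0.
  have e2 : 0 < e / 2 by rewrite divr_gt0.
  have [q qf] := gen_z _ e2.
  have := gl _ _ qf; have := qf 0 K0; rewrite g0 => q0f q0l.
  rewrite (_ : l - f 0 = (q.[0] - f 0) - (q.[0] - l)); last by ring.
  by rewrite (le_trans (ler_normB _ _))// (splitr e) lerD.
(* Re g takes no two opposite signs, as it has at most one zero l0; if it has none,
   any l0 other than l1 and l2 does. *)
have opposite l1 l2 : `|l1| = 1 -> `|l2| = 1 ->
    0 < complex.Re (g l1) -> complex.Re (g l2) < 0 -> False.
  move=> n1 n2 g1 g2'.
  suff [l0 [n0 l10 l20 gN0]] : exists l0, [/\ `|l0| = 1, l1 != l0, l2 != l0 &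
      forall l, `|l| = 1 -> l != l0 -> complex.Re (g l) != 0].
    have := @circle_sign_constant _ g l0 l1 l2 g_app n0 n1 n2 l10 l20 gN0 g1.
    by move=> /(lt_trans g2'); rewrite ltxx.
  have [[l0 n0 gl0]|noz] := pselect (exists2 l0, `|l0| = 1 & complex.Re (g l0) = 0).
    exists l0; split => //.
    - by apply: contraTneq g1 => ->; rewrite gl0 ltxx.
    - by apply: contraTneq g2' => ->; rewrite gl0 ltxx.
    - move=> l nl; apply: contraNneq => gl.
      by rewrite (g_zero _ n0 gl0) (g_zero _ nl gl).
  have gN0 l : `|l| = 1 -> complex.Re (g l) != 0.
    by move=> nl; apply/eqP => gl; apply: noz; exists l.
  have l1N0 : l1 != 0 by rewrite -normr_eq0 n1 oner_eq0.
  have iN0 : (1 : C) != 'i by rewrite eq_complex /= oner_eq0.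
  have [l2E|l2E] := eqVneq l2 (- l1); last first.
    exists (- l1); split => //; first by rewrite normrN.
      by rewrite -subr_eq0 opprK -mulr2n mulrn_eq0.
    by move=> l nl _; exact: gN0.
  exists ('i * l1); rewrite l2E normrM n1 mulr1; split.
  - by rewrite normc_def /= expr0n add0r expr1n sqrtr1.
  - by rewrite -subr_eq0 -[X in X - _]mul1r -mulrBl mulf_neq0// subr_eq0.
  - rewrite -subr_eq0 -mulN1r -mulrBl mulf_neq0// subr_eq0 eq_complex /= oppr0.
    by rewrite oppr_eq0 oner_eq0.
  - by move=> l nl _; exact: gN0.
(* The sign s = 1 or -1 of Re g on the circle. *)
have [s [s1 gs]] : exists s : R, s ^+ 2 = 1 /\
    forall l, `|l| = 1 -> 0 <= s * complex.Re (g l).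
  have [[l1 n1 g1]|nog] := pselect (exists2 l1, `|l1| = 1 & 0 < complex.Re (g l1)).
    exists 1; split => [|l nl]; first by rewrite expr1n.
    by rewrite mul1r leNgt; apply/negP => /(opposite _ _ n1 nl g1).
  exists (- 1); split => [|l nl]; first by rewrite sqrrN expr1n.
  by rewrite mulN1r oppr_ge0 leNgt; apply/negP => gl; apply: nog; exists l.
have g3 l : `|l| = 1 -> `|g l - (2 * s)%:C| <= 3.
  move=> nl; have := gs _ nl; have := g2 _ nl; case: (g l) => a b /= ab sa.
  have {}ab : a ^+ 2 + b ^+ 2 <= 4.
    rewrite -lecR (add_Re2_Im2 (a +i* b)).
    have -> : 4%:C = 2 ^+ 2 :> C by rewrite -natrX rmorph_nat.
    by rewrite lerXn2r ?nnegrE ?normr_ge0.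
  rewrite normc_def /= subr0 -(rmorph_nat (real_complex R)) lecR.
  rewrite -[leRHS]ger0_norm// -sqrtr_sqr ler_wsqrtr//.
  rewrite (_ : _ + _ = (a ^+ 2 + b ^+ 2) - 4 * (s * a) + 4 * s ^+ 2); last by ring.
  by rewrite s1; lra.
have e4 : 0 < (1 / 4)%:C :> C by rewrite ltcR; lra.
have [p pf] := gen_f _ e4.
pose z0 : C := - (2 * s)%:C.
have Kz0 : K z0.
  move/eqP: s1; rewrite sqrf_eq1 /z0 => /orP[] /eqP->.
    right; rewrite /= mulr1 rmorph_nat.
    by rewrite (_ : - 2 + 1 = -1) ?normrN ?normr1//; ring.
  left; rewrite /= mulrN1 rmorphN rmorph_nat opprK.
  by rewrite (_ : 2 - 1 = 1) ?normr1//; ring.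
have p_circle l : `|l| = 1 -> `|(p - (2 * s)%:C%:P).[l]| <= (13 / 4)%:C.
  move=> nl; have [/(_ _ _ pf) pg _ _] := gP _ nl; rewrite !hornerE.
  rewrite (_ : _ - _ = (p.[l] - g l) + (g l - (2 * s)%:C)); last by ring.
  rewrite (le_trans (ler_normD _ _))// (le_trans (lerD pg (g3 _ nl)))//.
  by rewrite -(rmorph_nat (real_complex R)) -rmorphD lecR; lra.
have := max_modulus p_circle (f1 _ Kz0); have := pf _ Kz0.
rewrite !hornerE => near_z0 near_center.
have := le_trans (ler_normB _ _) (lerD near_center near_z0).
rewrite (_ : _ - _ = (- (4 * s))%:C); last by rewrite /z0 rmorphN !rmorphM !rmorph_nat; ring.
rewrite -rmorphD normc_def /= expr0n addr0 lecR sqrtr_sqr normrN normrM.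
have -> : `|s| = 1 by apply/eqP; rewrite -(@pexpr_eq1 _ _ 2)// real_normK ?num_real// s1.
by rewrite ger0_norm//; lra.
Qed.

End two_discs_versus_disc.

(** * C*-algebras and their characters *)

Section complex_cstar_algebra.
Variable R : realType.
Local Notation C := R[i].

Lemma conjc_starD (x y : C) : conjc (x + y) = conjc x + conjc y.
Proof. exact: (rmorphD (@conjc R)). Qed.
Lemma conjc_starM (x y : C) : conjc (x * y) = conjc y * conjc x.
Proof. by rewrite mulrC; exact: (rmorphM (@conjc R)). Qed.
Lemma conjc_starZ (k x : C) : conjc (k *: (x : C^o)) = k^* *: (conjc x : C^o).
Proof. exact: (rmorphM (@conjc R)). Qed.
Lemma complex_scaleAl (k x y : C) : (k *: (x : C^o)) * y = k *: (x * y : C^o).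
Proof. exact: esym (mulrA k x y). Qed.
Lemma complex_scaleAr (k x y : C) : x * (k *: (y : C^o)) = k *: (x * y : C^o).
Proof. exact: mulrCA. Qed.
Lemma complex_normM (x y : C) : `|x * y| <= `|x| * `|y|.
Proof. by rewrite normrM. Qed.
Lemma complex_norm_star (x : C) : `|conjc x * x| = `|x| ^+ 2.
Proof. by rewrite normrM normcJ. Qed.

HB.instance Definition _ := @isCstarAlgebra.Build R C *%R (@conjc R)
  (@mulrA _) (@mulrDl _) (@mulrDr _) complex_scaleAl complex_scaleAr
  (@conjcK R) conjc_starD conjc_starZ conjc_starM complex_normM complex_norm_star.
End complex_cstar_algebra.

Section cstar_lemmas.
Variables (R : realType) (T : cstarAlgType R).
Local Notation C := R[i].
Implicit Types (x y b c : T).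

Lemma linear_scale (U V : lmodType C) (f : U -> V) k w :
  linear f -> f (k *: w) = k *: f w.
Proof.
move=> fl; have f0 : f 0 = 0.
  by have := fl (- 1) 0 0; rewrite scaler0 addr0 scaleN1r addNr.
by have := fl k w 0; rewrite !addr0 f0 addr0.
Qed.

Lemma cmul0r x : cmul x 0 = 0 :> T.
Proof. by have := cmulZr (0 : C) x 0; rewrite !scale0r. Qed.

Lemma cmulNr x y : cmul x (- y) = - cmul x y.
Proof. by have := cmulZr (-1 : C) x y; rewrite !scaleN1r. Qed.

Lemma cmulBr x y z : cmul x (y - z) = cmul x y - cmul x z :> T.
Proof. by rewrite cmulDr cmulNr. Qed.

Lemma cstar0 : cstar 0 = 0 :> T.
Proof.
have := cstarZ (0 : C) (0 : T); rewrite scale0r => ->.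
by rewrite (rmorph0 (@conjc R)) scale0r.
Qed.

Lemma cstar_conjc (k : C) x : cstar (k *: x) = conjc k *: cstar x.
Proof. by rewrite cstarZ. Qed.

Lemma cstarN x : cstar (- x) = - cstar x.
Proof.
by apply/eqP; rewrite -addr_eq0 -cstarD addNr cstar0.
Qed.

Lemma cnorm_starr x : `|cstar x| = `|x|.
Proof.
have le_star (y : T) : `|y| <= `|cstar y|.
  have [->|y0] := eqVneq y 0; first by rewrite cstar0.
  rewrite -(@ler_pM2r _ `|y|) ?normr_gt0// -expr2 -cnorm_star.
  exact: cnormM.
by apply/eqP; rewrite eq_le le_star -{2}(cstarK x) le_star.
Qed.

Lemma Re_norm x : (complex.Re `|x|)%:C = `|x|.
Proof. by rewrite RRe_real// ger0_real. Qed.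

(** The Neumann series b = c + c ^ 2 + c ^ 3 + ... of a possibly nonunital
    algebra. *)
Lemma neumann c : `|c| < 1 -> exists b, b = c + cmul c b.
Proof.
move=> c1; pose u n := iter n (cmul c) c.
have un n : `|u n| <= `|c| ^+ n.
  elim: n => [|n IH] /=; first by rewrite expr0 ltW.
  by rewrite exprS (le_trans (cnormM _ _))// ler_wpM2l.
have uS n : \sum_(0 <= k < n.+1) u k = c + cmul c (\sum_(0 <= k < n) u k).
  elim: n => [|n IH]; first by rewrite big_nat1 big_geq// cmul0r addr0.
  by rewrite big_nat_recr//= {1}IH [in RHS]big_nat_recr//= cmulDr addrA.
have tail n m : `|\sum_(n <= k < m) u k| <= `|c| ^+ n * (1 - `|c|)^-1.
  rewrite (le_trans (ler_norm_sum _ _ _))//.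
  apply: (@le_trans _ _ (\sum_(n <= k < m) `|c| ^+ k)); first exact: ler_sum.
  rewrite -{1}(add0n n) big_addn big_mkord.
  under eq_bigr do rewrite addnC exprD.
  rewrite -mulr_sumr ler_wpM2l ?exprn_ge0//.
  by have := @norm_geometric_le R `|c| (m - n); rewrite normr_id; apply.
have cu : cvg (series u @ \oo).
  apply/cauchy_cvgP/cauchy_seriesP => _ /gt0_realC[e e0 ->].
  have cr : complex.Re `|c| < 1 by rewrite -ltcR Re_norm.
  have cr0 : 0 <= complex.Re `|c| by rewrite -ler0c Re_norm.
  have d0 : 0 < e / 2 * (1 - complex.Re `|c|) by rewrite mulr_gt0// ?subr_gt0//; lra.
  have [N cN] := exists_exp_le cr0 cr d0.
  exists ([set n | (N <= n)%N], [set n | (N <= n)%N]); first by split; exists N.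
  move=> [n m] [/= Nn Nm]; rewrite (le_lt_trans (tail n m))//.
  rewrite ltr_pdivrMr ?subr_gt0//.
  apply: (@le_lt_trans _ _ (`|c| ^+ N)); first by rewrite ler_wiXn2l// ltW.
  rewrite -Re_norm -rmorphXn -(rmorph1 (real_complex R)) -rmorphB -rmorphM ltcR.
  rewrite (le_lt_trans cN)// ltr_pM2r ?subr_gt0//; lra.
exists (lim (series u @ \oo)); set b := lim _.
apply/eqP; rewrite -subr_eq0 -normr_le0.
apply/ler_addgt0Pl => e e0; rewrite addr0.
have e2 : 0 < e / 2 by rewrite divr_gt0.
have /cvgrPdist_lt/(_ _ e2)[N _ Nb] := cu.
have bN : `|b - series u N| < e / 2 by apply: (Nb N) => /=.
have bN1 : `|b - series u N.+1| < e / 2 by apply: (Nb N.+1) => /=.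
rewrite (_ : b - _ = (b - series u N.+1) - cmul c (b - series u N)); last first.
  by rewrite cmulBr /series/= uS opprB !opprD -!addrA addKr.
rewrite (le_trans (ler_normB _ _))// (splitr e) lerD ?(ltW bN1)//.
rewrite (le_trans (cnormM _ _))// (le_trans _ (ltW bN))//.
by rewrite ler_piMl// ltW.
Qed.

(** If |h y| > |y|, then c = y / h y has norm less than 1 and h c = 1, so applying
    h to b = c + c b gives h b = 1 + h b. *)
Lemma character_contractive (h : T -> C) :
  star_morphism h -> forall y, `|h y| <= `|y|.
Proof.
case=> hl hM0 _ y;
have hM x z : h (cmul x z) = h x * h z by exact: hM0.
 rewrite real_leNgt ?normr_real//; apply/negP => yh.
have hy0 : h y != 0 by rewrite -normr_gt0 (le_lt_trans _ yh).
have hZ k x : h (k *: x) = k * h x.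
  have h0 : h 0 = 0 by have := hl (-1) 0 0; rewrite scaler0 addr0 scaleN1r addNr.
  by have := hl k x 0; rewrite !addr0 h0 addr0.
have hD x z : h (x + z) = h x + h z by have := hl 1 x z; rewrite !scale1r.
have [|b bE] := @neumann ((h y)^-1 *: y).
  by rewrite normrZ normfV ltr_pdivrMl ?normr_gt0// mulr1.
have /(congr1 h) := bE; rewrite hD hM hZ mulVf// mul1r => /eqP.
by rewrite -subr_eq0 opprD addrCA subrr addr0 oppr_eq0 oner_eq0.
Qed.

Lemma colnorm1 (b : 'cV[T]_1) : colnorm b = complex.Re `|b 0 0|.
Proof.
rewrite /colnorm big_ord1 cnorm_star -Re_norm -rmorphXn /=.
by rewrite sqrtr_sqr ger0_norm// -ler0c Re_norm.
Qed.

(** The supremum is attained at the normalized adjoint of the entry. *)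
Lemma matnorm1 (M : 'M[T]_1) : (matnorm M)%:C = `|M 0 0|.
Proof.
rewrite -Re_norm; congr (_%:C); rewrite /matnorm; set m := M 0 0; set E := mkset _.
have actE (b : 'cV[T]_1) : colnorm (mxaction M b) = complex.Re `|cmul m (b 0 0)|.
  by rewrite colnorm1 /mxaction mxE big_ord1.
set S := (X in sup X).
have ubS : ubound S (complex.Re `|m|).
  move=> _ [b b1 <-]; rewrite actE -lecR !Re_norm (le_trans (cnormM _ _))//.
  by rewrite ler_piMr//; move: b1; rewrite /E /= colnorm1 -lecR Re_norm.
have S0 : S 0.
  exists 0; last by rewrite actE mxE cmul0r normr0.
  by rewrite /E /= colnorm1 mxE normr0.
apply/eqP; rewrite eq_le; apply/andP; split.
  by apply: ge_sup => //; exists 0.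
apply: ub_le_sup; first by exists (complex.Re `|m|).
have [m0|mN0] := eqVneq m 0; first by rewrite m0 normr0.
exists (const_mx (`|m|^-1 *: cstar m)).
  rewrite /E /= colnorm1 mxE normrZ cnorm_starr normfV normr_id mulVf ?normr_eq0//.
rewrite actE mxE cmulZr normrZ normfV normr_id.
rewrite -{2}(cstarK m) cnorm_star cnorm_starr expr2 mulKf// normr_eq0//.
Qed.
End cstar_lemmas.

(** * Subalgebras isometric to a uniform algebra *)

(** The evaluations of Phi at the points of K are contractive characters of S, and
    they determine the norm and the elements of S. *)
Record isometric_on (R : realType) (K : topologicalType) (cK : compact [set: K])
    (T : cstarAlgType R) (S : set T) (Phi : T -> contalg R cK) : Prop := {
  isometric_subalgebra : closed_subalgebra S;
  isometric_linear : forall (k : R[i]) x y, S x -> S y ->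
    Phi (k *: x + y) = k *: Phi x + Phi y;
  isometricM : forall x y, S x -> S y -> Phi (cmul x y) = cmul (Phi x) (Phi y);
  isometric_norm : forall x, S x -> `|Phi x| = `|x|
}.

Section isometric_on.
Variables (R : realType) (K : topologicalType) (cK : compact [set: K]).
Variables (T : cstarAlgType R) (S : set T) (Phi : T -> contalg R cK).
Variable iso : isometric_on S Phi.
Local Notation C := R[i].
Implicit Types (x y : T) (z : K) (k : C) (p : {poly C}).

Lemma subalgebra0 : S 0.
Proof. by case: (isometric_subalgebra iso). Qed.

Lemma subalgebra_lin k x y : S x -> S y -> S (k *: x + y).
Proof. by case: (isometric_subalgebra iso) => _ _ + _; apply. Qed.

Lemma subalgebraZ k x : S x -> S (k *: x).
Proof. by move=> Sx; rewrite -[_ *: _]addr0; apply: subalgebra_lin => //; exact: subalgebra0. Qed.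

Lemma subalgebraD x y : S x -> S y -> S (x + y).
Proof. by move=> Sx; rewrite -[x]scale1r; exact: subalgebra_lin. Qed.

Lemma subalgebraB x y : S x -> S y -> S (x - y).
Proof. by move=> Sx Sy; rewrite addrC -scaleN1r; exact: subalgebra_lin. Qed.

Lemma subalgebraM x y : S x -> S y -> S (cmul x y).
Proof. by case: (isometric_subalgebra iso) => _ _ _; apply. Qed.

Lemma eval_lin k x y z : S x -> S y -> Phi (k *: x + y) z = k * Phi x z + Phi y z.
Proof. by move=> Sx Sy; rewrite (isometric_linear iso). Qed.

Lemma eval0 z : Phi 0 z = 0.
Proof.
have := eval_lin (- 1) z subalgebra0 subalgebra0.
by rewrite scaler0 addr0 mulN1r addNr.
Qed.

Lemma evalZ k x z : S x -> Phi (k *: x) z = k * Phi x z.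
Proof.
by move=> Sx; have := eval_lin k z Sx subalgebra0; rewrite eval0 !addr0.
Qed.

Lemma evalD x y z : S x -> S y -> Phi (x + y) z = Phi x z + Phi y z.
Proof. by move=> Sx Sy; have := eval_lin 1 z Sx Sy; rewrite scale1r mul1r. Qed.

Lemma evalB x y z : S x -> S y -> Phi (x - y) z = Phi x z - Phi y z.
Proof.
move=> Sx Sy; have := eval_lin (- 1) z Sy Sx.
by rewrite scaleN1r mulN1r addrC => ->; rewrite addrC.
Qed.

Lemma evalM x y z : S x -> S y -> Phi (cmul x y) z = Phi x z * Phi y z.
Proof. by move=> Sx Sy; rewrite (isometricM iso). Qed.

Lemma eval_le x z : S x -> `|Phi x z| <= `|x|.
Proof. by move=> Sx; rewrite -(isometric_norm iso Sx) contalg_normE supnorm_ub. Qed.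

Lemma norm_le_eval x (M : C) : 0 <= M -> S x -> (forall z, `|Phi x z| <= M) -> `|x| <= M.
Proof.
move=> M0 Sx xM; rewrite -(isometric_norm iso Sx) contalg_normE.
have Mr : M = (complex.Re M)%:C by rewrite RRe_real// ger0_real.
move: M0 xM; rewrite Mr ler0c lecR => M0 xM.
exact: supnorm_le.
Qed.

Lemma eval_inj x y : S x -> S y -> Phi x =1 Phi y -> x = y.
Proof.
move=> Sx Sy xy; apply/eqP; rewrite -subr_eq0 -normr_le0.
by apply: norm_le_eval (subalgebraB Sx Sy) _ => // z; rewrite evalB// xy subrr normr0.
Qed.

Lemma subalgebra_cmulC x y : S x -> S y -> cmul x y = cmul y x.
Proof.
move=> Sx Sy; apply: eval_inj; [exact: subalgebraM..|].
by move=> z; rewrite !evalM// mulrC.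
Qed.

Section unit.
Variables (e : T) (Se : S e) (e1 : forall z, Phi e z = 1).

Lemma unit_cmul x : S x -> cmul e x = x.
Proof.
move=> Sx; apply: eval_inj => //; first exact: subalgebraM.
by move=> z; rewrite evalM// e1 mul1r.
Qed.

Lemma cmul_unit x : S x -> cmul x e = x.
Proof. by move=> Sx; rewrite subalgebra_cmulC// unit_cmul. Qed.

Lemma norm_unit_le : `|e| <= 1.
Proof. by apply: norm_le_eval => // z; rewrite e1 normr1. Qed.

(** Arens' argument: y + i s e has squared norm at most |y| ^ 2 + s ^ 2 for every
    real s, which is only compatible with a contractive character having a real
    value at y. The adjoint of e enters only through e^* y = (y e)^* = y and the
    norm of e^* e. *)
Lemma eval_selfadjoint y z : S y -> cstar y = y -> complex.Im (Phi y z) = 0.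
Proof.
move=> Sy ysa; apply/eqP; apply: contraT => b0.
set b := complex.Im _ in b0; pose a := complex.Re (Phi y z).
have bound (s : R) : (a ^+ 2 + (b + s) ^+ 2)%:C <= `|y| ^+ 2 + (s ^+ 2)%:C.
  pose w := y + (s *i) *: e.
  have Sw : S w by apply: subalgebraD => //; exact: subalgebraZ.
  have wz : Phi w z = a +i* (b + s).
    rewrite /w evalD//; last exact: subalgebraZ.
    by rewrite evalZ// e1 mulr1 /a /b; case: (Phi y z) => ? ?; simpc.
  have -> : (a ^+ 2 + (b + s) ^+ 2)%:C = `|Phi w z| ^+ 2 by rewrite wz -add_Re2_Im2.
  rewrite (@le_trans _ _ (`|w| ^+ 2)) ?lerXn2r ?nnegrE ?eval_le//.
  rewrite -cnorm_star.
  have e_y : cmul (cstar e) y = y.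
    by rewrite -{1}ysa -cstarM cmul_unit.
  have -> : cmul (cstar w) w = cmul y y + (s ^+ 2)%:C *: cmul (cstar e) e.
    rewrite /w cstarD cstar_conjc ysa !cmulDl !cmulDr !cmulZl !cmulZr cmul_unit// e_y scalerA.
    have -> : conjc (s *i) = - (s *i) by simpc.
    have -> : - s *i * s *i = (s ^+ 2)%:C by simpc.
    by rewrite scaleNr addrA addrK.
  rewrite (le_trans (ler_normD _ _))// lerD//.
    by rewrite (le_trans (cnormM _ _)) ?expr2.
  rewrite normrZ ger0_norm ?ler0c ?sqr_ge0// ler_piMr ?ler0c ?sqr_ge0//.
  by rewrite cnorm_star -(expr1n _ 2) lerXn2r ?nnegrE ?norm_unit_le.
set N := complex.Re `|y|.
have := bound ((N ^+ 2 + 1) / (2 * b)); rewrite -Re_norm -/N -rmorphXn -rmorphD lecR.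
have -> : (b + (N ^+ 2 + 1) / (2 * b)) ^+ 2 =
    b ^+ 2 + (N ^+ 2 + 1) + ((N ^+ 2 + 1) / (2 * b)) ^+ 2 by field.
by have := sqr_ge0 a; have := sqr_ge0 b; lra.
Qed.

Lemma eval_cstar y z : S y -> S (cstar y) -> Phi (cstar y) z = conjc (Phi y z).
Proof.
move=> Sy Sys.
have := @eval_selfadjoint (y + cstar y) z (subalgebraD Sy Sys).
rewrite cstarD cstarK addrC => /(_ erefl); rewrite evalD//.
have := @eval_selfadjoint ('i *: (y - cstar y)) z (subalgebraZ _ (subalgebraB Sy Sys)).
rewrite cstar_conjc evalZ ?evalB//; last exact: subalgebraB.
have -> : conjc 'i = - 'i :> C by simpc.
rewrite cstarD cstarN cstarK scaleNr -scalerN opprD opprK addrC => /(_ erefl).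
case: (Phi y z) => a b; case: (Phi (cstar y) z) => c d /=.
by simpc => /= ac bd; congr (_ +i* _); lra.
Qed.
End unit.

End isometric_on.

(** * Polynomial approximation and P(K) *)

Section polynomial_approximation.
Variables (R : realType) (K : topologicalType) (cK : compact [set: K]).
Variables (T : cstarAlgType R) (S : set T) (Phi : T -> contalg R cK).
Variable iso : isometric_on S Phi.
Local Notation C := R[i].
Implicit Types (x y v : T) (z : K) (k : C) (p q : {poly C}).

Lemma closure_dist (V : normedModType C) (A : set V) (x : V) (e : C) :
  closure A x -> 0 < e -> exists2 y, A y & `|x - y| < e.
Proof.
move=> clx e0; have [|y [Ay]] := clx [set y | `|x - y| < e].
  by apply/nbhs_normP; exists e.
by exists y.
Qed.

Lemma star_morphism_lin (h : T -> C) k x y :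
  star_morphism h -> h (k *: x + y) = k * h x + h y.
Proof. by case=> + _ _; apply. Qed.

Lemma star_morphismZ (h : T -> C) k x : star_morphism h -> h (k *: x) = k * h x.
Proof. by case=> hl _ _; exact: linear_scale. Qed.

Lemma star_morphism_mul (h : T -> C) x y :
  star_morphism h -> h (cmul x y) = h x * h y.
Proof. by case=> _ + _; apply. Qed.

(** The element y is p(v), with e as the unit. *)
Lemma poly_calculus (e v : T) p : S e -> (forall z, Phi e z = 1) -> S v ->
  exists y, [/\ S y, forall z, Phi y z = p.[Phi v z] &
    forall h : T -> C, star_morphism h -> h e = 1 -> h y = p.[h v]].
Proof.
move=> Se e1 Sv; elim/poly_ind: p => [|p c [y [Sy yz yh]]].
  exists (0 *: e); split=> [|z|h hm h1].
  - exact: (subalgebraZ iso).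
  - by rewrite (evalZ iso)// mul0r horner0.
  - by rewrite star_morphismZ// mul0r horner0.
have Syv : S (cmul y v) by exact: (subalgebraM iso).
exists (c *: e + cmul y v); split=> [|z|h hm h1].
- exact: (subalgebra_lin iso).
- by rewrite (eval_lin iso)// (evalM iso)// e1 mulr1 yz hornerMXaddC addrC.
- rewrite star_morphism_lin// star_morphism_mul// (yh h hm h1) h1 mulr1.
  by rewrite hornerMXaddC addrC.
Qed.

Lemma character_eval_le (h : T -> C) x y (M : C) : star_morphism h -> 0 <= M ->
  S x -> S y -> (forall z, `|Phi x z - Phi y z| <= M) -> `|h x - h y| <= M.
Proof.
move=> hm M0 Sx Sy xyM; have Sxy := subalgebraB iso Sx Sy.
have -> : h x - h y = h (x - y).
  by have := star_morphism_lin (- 1) y x hm; rewrite scaleN1r mulN1r addrC => ->; rewrite addrC.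
rewrite (le_trans (character_contractive hm _))//.
by apply: (norm_le_eval iso) => // z; rewrite (evalB iso).
Qed.

Definition poly_approximable (F : K -> C) : set T := [set y | S y /\
  forall e : C, 0 < e -> exists p, forall z, `|p.[F z] - Phi y z| <= e].

(** The uniform limits of polynomials in F form a closed algebra, which is pulled
    back to S along Phi. *)
Lemma poly_approximable_subalgebra F : closed_subalgebra (poly_approximable F).
Proof.
have [clS _ _ _] := isometric_subalgebra iso.
split.
- move=> y cly; have Sy : S y.
    apply: clS => B /cly[w [[Sw _] Bw]]; by exists w.
  split=> // e e0; have e2 : 0 < e / 2 by rewrite divr_gt0.
  have [w [Sw wF] yw] := closure_dist cly e2.
  have [p pw] := wF _ e2; exists p => z.
  rewrite (_ : _ - _ = (p.[F z] - Phi w z) - (Phi y z - Phi w z)); last by ring.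
  rewrite (le_trans (ler_normB _ _))// (splitr e) lerD// -(evalB iso)//.
  by rewrite (le_trans (eval_le iso _ _)) ?(ltW yw)//; exact: (subalgebraB iso).
- split=> [|e e0]; first exact: subalgebra0 iso.
  by exists 0 => z; rewrite horner0 (eval0 iso) subrr normr0 ltW.
- move=> k x y [Sx xF] [Sy yF]; split=> [|e e0]; first exact: (subalgebra_lin iso).
  have k0 : 0 < `|k| + 1 by rewrite ltr_wpDl.
  have d0 : 0 < e / (`|k| + 1) by rewrite divr_gt0.
  have [p px] := xF _ d0; have [q qy] := yF _ d0.
  exists (k *: p + q) => z; rewrite (eval_lin iso)// hornerD hornerZ.
  rewrite (_ : _ - _ = k * (p.[F z] - Phi x z) + (q.[F z] - Phi y z)); last by ring.
  rewrite (le_trans (ler_normD _ _))// normrM.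
  rewrite (le_trans (lerD (ler_wpM2l (normr_ge0 _) (px z)) (qy z)))//.
  rewrite (_ : _ + _ = (`|k| + 1) * (e / (`|k| + 1))); last by ring.
  by rewrite mulrC divfK// gt_eqF.
move=> x y [Sx xF] [Sy yF]; split=> [|e e0]; first exact: (subalgebraM iso).
pose m : C := `|x| + `|y| + 1.
have m0 : 0 < m by rewrite ltr_wpDl// addr_ge0.
have me0 : 0 < m + e by rewrite addr_gt0.
pose d : C := e / (m + e).
have d0 : 0 < d by rewrite divr_gt0.
have d1 : d <= 1 by rewrite ler_pdivrMr// mul1r lerDr ltW.
have dm : d * m <= e.
  by rewrite mulrAC ler_pdivrMr// ler_pM2l// lerDl ltW.
have [p px] := xF _ d0; have [q qy] := yF _ d0.
exists (p * q) => z; rewrite (evalM iso)// hornerM.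
rewrite (_ : _ - _ = (p.[F z] - Phi x z) * (q.[F z] - Phi y z) +
  (p.[F z] - Phi x z) * Phi y z + Phi x z * (q.[F z] - Phi y z)); last by ring.
rewrite (le_trans _ dm)// (_ : d * m = d * 1 + d * `|y| + `|x| * d); last by rewrite /m; ring.
rewrite (le_trans (ler_normD _ _))// lerD//; last first.
  by rewrite normrM ler_pM// (eval_le iso).
rewrite (le_trans (ler_normD _ _))// lerD//; rewrite normrM ler_pM//.
  by rewrite (le_trans (qy z)).
by rewrite (eval_le iso).
Qed.
End polynomial_approximation.

Section two_discs_algebra.
Variable R : realType.
Local Notation C := R[i].
Local Notation K := (set_type (two_discs R)).
Local Notation CK := (contalg R (compact_set_type (two_discs_compact R))).
Local Notation PK := (polynomial_algebra (two_discs_compact R)).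

Lemma polynomial_mem (p : {poly C}) : exists2 F : CK, PK F & forall z : K, F z = p.[set_val z].
Proof.
have cp : continuous (fun z : K => p.[set_val z] : C).
  move=> z; apply: (@continuous_comp _ _ _ (fun z : K => set_val z : C) (fun w => p.[w])).
    exact: initial_continuous.
  exact: horner_continuous.
exists (mkcts cp : CK) => //; apply: subset_closure; by exists p.
Qed.

Lemma polynomial_algebra_approx (F : CK) (e : C) : PK F -> 0 < e ->
  exists p : {poly C}, forall z : K, `|p.[set_val z] - F z| <= e.
Proof.
move=> PF e0; have [G [p Gp] FG] := closure_dist PF e0.
exists p => z; rewrite -Gp distrC (le_trans (supnorm_ub (F - G) z))// ltW//.
Qed.

Lemma two_discs_point (z : C) : two_discs R z -> exists w : K, set_val w = z.
Proof. by move=> Kz; exists (exist _ z (mem_set Kz)). Qed.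

Lemma two_discs_extend (F : K -> C) : exists f : C -> C, forall z : K, f (set_val z) = F z.
Proof.
exists (fun z => if pselect (exists w : K, set_val w = z) is left h
  then F (sval (cid h)) else 0) => z.
case: pselect => [h|[]]; last by exists z.
by congr F; apply: val_inj; exact: (svalP (cid h)).
Qed.

(** F is constant on each of the two discs, and these meet at 0. *)
Lemma polynomial_algebra_conj_const (F G : CK) : PK F -> PK G ->
  (forall z, G z = conjc (F z)) -> forall z w, F z = F w.
Proof.
move=> PF PG FG; have [f fF] := two_discs_extend F.
have disc (c : C) : (forall z, `|z - c| <= 1 -> two_discs R z) ->
    forall z, `|z - c| <= 1 -> f z = f c.
  move=> cK; apply: const_of_conj_approx => e e0.
  have [p pF] := polynomial_algebra_approx PF e0.
  have [q qG] := polynomial_algebra_approx PG e0.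
  exists p, q => z /cK/two_discs_point[w <-]; rewrite fF -FG.
  by split; [exact: pF|exact: qG].
have right_disc (z : C) : `|z - 1| <= 1 -> f z = f 1.
  by apply: disc => w; left.
have left_disc (z : C) : `|z + 1| <= 1 -> f z = f (- 1).
  by rewrite -{1}(opprK 1); apply: disc => w; rewrite opprK; right.
have f0 : f (- 1) = f 1.
  by rewrite -(left_disc 0) ?add0r ?normr1// right_disc// sub0r normrN normr1.
have all_f1 (z : K) : F z = f 1.
  by rewrite -fF; have [/right_disc|/left_disc->] := set_valP z.
by move=> z w; rewrite !all_f1.
Qed.
End two_discs_algebra.

(** * Tensor algebras *)

Section correspondence_over_scalars.
Variables (R : realType) (A : cstarAlgType R) (X : correspondenceType A).
Variables (T : cstarAlgType R) (pi : A -> T) (t : X -> T).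
Local Notation C := R[i].
Local Notation K := (set_type (two_discs R)).
Local Notation CK := (contalg R (compact_set_type (two_discs_compact R))).
Local Notation PK := (polynomial_algebra (two_discs_compact R)).
Local Notation S := (tensor_algebra pi t).
Variable Phi : T -> CK.

Lemma tensor_algebra_subalgebra : closed_subalgebra S.
Proof.
split.
- by apply: closed_bigI => M [[]].
- by move=> M [[]].
- move=> k x y Sx Sy M MP; have [[_ _ + _] _] := MP.
  by apply; [exact: Sx|exact: Sy].
- move=> x y Sx Sy M MP; have [[_ _ _ +] _] := MP.
  by apply; [exact: Sx|exact: Sy].
Qed.

Lemma tensor_algebra_pi a : S (pi a).
Proof. by apply: sub_gen_smallest; left; exists a. Qed.

Lemma tensor_algebra_t x : S (t x).
Proof. by apply: sub_gen_smallest; right; exists x. Qed.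

Lemma tensor_algebra_approximable (iso : isometric_on S Phi) (F : K -> C) :
  (forall a, exists k, forall z, Phi (pi a) z = k) ->
  (forall x, exists k, forall z, Phi (t x) z = k * F z) ->
  S `<=` poly_approximable S Phi F.
Proof.
move=> piF tF; apply: smallest_sub; first exact: (poly_approximable_subalgebra iso).
move=> _ [[a _ <-]|[x _ <-]].
- split; first exact: tensor_algebra_pi.
  move=> e e0; have [k ak] := piF a; exists k%:P => z.
  by rewrite ak hornerC subrr normr0 ltW.
- split; first exact: tensor_algebra_t.
  move=> e e0; have [k xk] := tF x; exists (k *: 'X) => z.
  by rewrite xk hornerZ hornerX subrr normr0 ltW.
Qed.

(** The values of pi are multiples of the unit, and commutativity forces the range
    of t to be at most one-dimensional; so S either consists of scalars, or is
    generated by an isometry v whose image under characters of T covers the unit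
    circle, as in the disc algebra. *)
Lemma tensor_algebra_not_two_discs : universal_representation pi t ->
  isometric_on S Phi -> Phi @` S = PK -> False.
Proof.
move=> univ iso surj; have rep := universal_rep univ.
have S_pi := tensor_algebra_pi; have S_t := tensor_algebra_t.
have PK_Phi y : S y -> PK (Phi y) by rewrite -surj => Sy; exists y.
have lift p : exists2 y, S y & forall z : K, Phi y z = p.[set_val z].
  have [F + Fp] := polynomial_mem p; rewrite -surj => -[y Sy yF].
  by exists y => // z; rewrite yF.
have [e Se e1] : exists2 e, S e & forall z : K, Phi e z = 1.
  by have [e Se ep] := lift 1; exists e => // z; rewrite ep hornerC.
have [u Su uz] : exists2 u, S u & forall z : K, Phi u z = set_val z.
  by have [u Su up] := lift 'X; exists u => // z; rewrite up hornerX.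
have [z0 z0E] : exists z0 : K, set_val z0 = 1 :> C.
  by apply: two_discs_point; left; rewrite /= subrr normr0.
have [z1 z1E] : exists z1 : K, set_val z1 = -1 :> C.
  by apply: two_discs_point; right; rewrite /= addNr normr0.
(* Phi (pi a) and its conjugate both belong to PK, so pi takes values in C e. *)
pose c a := Phi (pi a) z0.
have pi_star a : pi (cstar a) = cstar (pi a) := star_morphism_star (rep_pi rep) a.
have S_pi_star a : S (cstar (pi a)) by rewrite -pi_star.
have pi_const a z : Phi (pi a) z = c a.
  apply: (@polynomial_algebra_conj_const _ (Phi (pi a)) (Phi (cstar (pi a)))).
  - exact: PK_Phi.
  - exact: PK_Phi.
  - by move=> w; exact: (eval_cstar iso Se e1).
have piE a : pi a = c a *: e.
  apply: (eval_inj iso) => //; first exact: (subalgebraZ iso).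
  by move=> z; rewrite pi_const (evalZ iso)// e1 mulr1.
have [t0|] := pselect (forall x, t x = 0).
  (* S consists of scalars, but the coordinate z has different values at 1 and -1. *)
  have := @tensor_algebra_approximable iso (fun=> 0) _ _ _ Su.
  case=> [a|x|_ /(_ (1 / 2) _)[|p pu]].
  - by exists (c a) => z.
  - by exists 0 => z; rewrite t0 (eval0 iso) mul0r.
  - by rewrite divr_gt0.
  have := le_trans (ler_normB _ _) (lerD (pu z0) (pu z1)).
  rewrite (_ : _ - _ = - 2); last by rewrite !uz z0E z1E; ring.
  rewrite normrN ger0_norm// -splitr.
  by rewrite lern1.
move=> /existsNP[x0 tx0].
have [a0 a0E] := inner_ge0 x0.
have cM a b : c (cmul a b) = c a * c b.
  by rewrite /c (star_morphismM (rep_pi rep)) (evalM iso).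
have c_star a : c (cstar a) = conjc (c a).
  by rewrite /c pi_star (eval_cstar iso Se e1).
have c_lin k a b : c (k *: a + b) = k * c a + c b.
  by rewrite /c (star_morphism_linear (rep_pi rep)) (eval_lin iso).
have ca0 : c a0 != 0.
  apply/eqP => ca0; apply: tx0; apply/eqP; rewrite -normr_eq0 -sqrf_eq0 -cnorm_star.
  by rewrite (rep_inner rep) piE a0E cM ca0 mulr0 scale0r normr0.
(* c a0 is a square root of the scalar <x0, x0>; it normalizes x0. *)
pose x1 := (c a0)^-1 *: x0; pose v := t x1.
have Sv : S v by exact: S_t.
have vv : cmul (cstar v) v = e.
  rewrite /v /x1 (linear_scale _ _ (rep_linear rep)) cstar_conjc cmulZl cmulZr.
  rewrite (rep_inner rep) piE a0E cM c_star !scalerA.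
  rewrite (_ : _ * _ = 1) ?scale1r//.
  by rewrite conjc_inv; field; rewrite conjc_eq0 ca0.
pose d x := c (inner x1 x).
have vt x : cmul (cstar v) (t x) = d x *: e by rewrite (rep_inner rep) piE.
(* t x = v^* v t(x) = v^* t(x) v = <x1, x> v, as S is commutative. *)
have tE x : t x = d x *: v.
  rewrite -[LHS](unit_cmul iso Se e1)// -vv -cmulA (subalgebra_cmulC iso Sv)//.
  by rewrite cmulA vt cmulZl (unit_cmul iso Se e1).
have d1 : d x1 = 1 by rewrite -(e1 z0) -vv (rep_inner rep).
(* Sending t x to l d x is a representation of X on the complex numbers. *)
have characters l : `|l| = 1 -> exists h : T -> C,
    [/\ star_morphism h, h e = 1 & h v = l].
  move=> l1; pose s x := l * d x.
  have rep_l : representation (c : A -> C) s.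
    split.
    - split=> [k a b|a b|a]; [exact: c_lin|exact: cM|exact: c_star].
    - move=> k x y; rewrite /s /d innerDr innerZr c_lin.
      by rewrite mulrDr mulrCA.
    - move=> a x; rewrite /s.
      have -> : d (lact a x) = c a * d x.
        have : d (lact a x) *: e = (c a * d x) *: e.
          rewrite -scalerA -!vt -(rep_lact rep) piE cmulZl (unit_cmul iso Se e1)//.
          by rewrite cmulZr.
        by move=> /(congr1 (fun y => Phi y z0)); rewrite !(evalZ iso)// e1 !mulr1.
      exact: mulrCA.
    - move=> x y; rewrite /s.
      have -> : c (inner x y) = conjc (d x) * d y.
        rewrite /c -(rep_inner rep) !tE cstar_conjc cmulZl cmulZr vv scalerA.
        by rewrite (evalZ iso)// e1 mulr1.
      transitivity ((l * conjc l) * (conjc (d x) * d y)); last first.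
        by rewrite -sqr_normc l1 expr1n mul1r.
      have -> : cstar (l * d x) = conjc l * conjc (d x) by exact: (rmorphM (@conjc R)).
      by rewrite [LHS]mulrACA [X in X * _]mulrC.
  have [h [[hm h_pi h_t] _]] := universalP univ rep_l.
  exists h; split => //; last by rewrite /v h_t /s d1 mulr1.
  by rewrite -vv (rep_inner rep) h_pi -[RHS]d1.
have v1 : `|v| <= 1.
  rewrite -(@ler_pXn2r _ 2) ?nnegrE// expr1n -cnorm_star vv.
  exact: (norm_unit_le iso).
have v_gen y : S y -> forall r : C, 0 < r ->
    exists p, forall z, `|p.[Phi v z] - Phi y z| <= r.
  suff S_approx : S `<=` poly_approximable S Phi (Phi v) by move=> /S_approx[].
  apply: (tensor_algebra_approximable iso) => [a|x]; first by exists (c a) => z.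
  by exists (d x) => z; rewrite tE (evalZ iso).
have [f fE] := two_discs_extend (Phi v).
apply: (@two_discs_no_disc_coordinate _ f).
- by move=> _ /two_discs_point[z <-]; rewrite fE (le_trans (eval_le iso _ _)).
- move=> r /(v_gen _ Su)[p pu]; exists p => _ /two_discs_point[z <-].
  by rewrite fE -uz.
- move=> r /(polynomial_algebra_approx (PK_Phi _ Sv))[p pv].
  by exists p => _ /two_discs_point[z <-]; rewrite fE.
move=> l /characters[h [hm he hv]]; exists (h u).
have in_K z : two_discs R (set_val (z : K)) by exact: set_valP.
split=> p r pr; have r0 : 0 <= r by apply: le_trans (pr _ (in_K z0)).
- have [y [Sy yz yh]] := poly_calculus iso p Se e1 Sv.
  rewrite -hv -yh//; apply: (character_eval_le iso) => // z.
  by rewrite yz uz -fE pr.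
- have [y [Sy yz yh]] := poly_calculus iso p Se e1 Su.
  rewrite -yh// -[h y]subr0.
  have h0 : h 0 = 0 by have := star_morphismZ 0 0 hm; rewrite scale0r mul0r.
  rewrite -h0; apply: (character_eval_le iso) => //.
    exact: (subalgebra0 iso).
  by move=> z; rewrite (eval0 iso) subr0 yz uz pr.
- have [y [Sy yz yh]] := poly_calculus iso p Se e1 Su.
  rewrite -yh// -hv; apply: (character_eval_le iso) => // z.
  by rewrite yz uz -fE pr.
Qed.
End correspondence_over_scalars.

Theorem mainTheorem6 (R : realType) :
  ~ exists (A : cstarAlgType R) (X : correspondenceType A)
      (T : cstarAlgType R) (pi : A -> T) (t : X -> T),
      universal_representation pi t /\
      completely_isometrically_isomorphic (tensor_algebra pi t)
        (polynomial_algebra (two_discs_compact R)).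
Proof.
move=> [A [X [T [pi [t [univ [Phi [surj lin mul matiso]]]]]]]].
apply: (@tensor_algebra_not_two_discs R A X T pi t Phi) => //.
split=> // [|x Sx]; first exact: tensor_algebra_subalgebra.
have Sx' (i j : 'I_1) : tensor_algebra pi t ((const_mx x : 'M_1) i j) by rewrite mxE.
by have := matiso 1%N _ Sx' => /(congr1 (real_complex R)); rewrite !matnorm1 !mxE.
Qed.
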